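(* Let $X_1,\dots,X_n$ be i.i.d. on $[0,1]$ with density $f$, and let $\phi(f)=\int_0^1 T(f(x))\,dx$ be a non-linear integral functional, where $T$ has bounded third derivative (and $T$ is not affine on $[M_*,M^*]$). Let $\beta^*\in(0,\tfrac14)$ and suppose that an estimator $\hat\phi=\hat\phi_n(X_1,\dots,X_n)$ of $\phi(f)$ satisfies $$\sup_{f\in H(\beta^* )}\mathbb E_f\big(\hat\phi-\phi(f)\big)^2\lesssim\Big(\frac{n^2}{\log n}\Big)^{-\frac{4\beta^*}{1+4\beta^*}} .$$ Then for any $\beta$ with $0<\beta<\beta^*$, $$\sup_{f\in H(\beta)}\mathbb E_f\big(\hat\phi-\phi(f)\big)^2\gtrsim\Big(\frac{n^2}{\log n}\Big)^{-\frac{4\beta}{1+4\beta}} .$$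
   Context: Fix constants $0<M_*<1<M^*\le C$. For $\beta\in(0,1)$, the Hölder ball $H(\beta,C)$ is the set of functions $h$ on $[0,1]$ with $|h|\le C$ and $|h(x)-h(y)|\le C|x-y|^{\beta}$ for all $x,y$. $H(\beta)$ denotes the set of probability densities $f\in H(\beta,C)$ on $[0,1]$ with $M_*\le f\le M^*$. $\mathbb E_f$ is expectation when $X_1,\dots,X_n$ are i.i.d. with density $f$. For positive sequences, $a_n\lesssim b_n$ means $\limsup a_n/b_n<\infty$, and $a_n\gtrsim b_n$ means $\liminf a_n/b_n>0$.
   Formalization: ''Non-linear'' is taken to mean that the functional φ is not affine on the class H(β* ); T not affine on [M_*,M^*] alone does not suffice, since the densities may never take values where T is non-affine, making φ constant and the claim false. *)

(* Defs.v *)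
From HB Require Import structures.
From mathcomp Require Import all_boot all_order all_algebra.
From mathcomp Require Import all_classical all_reals all_analysis.
From mathcomp Require Import measurable_realfun.

Set Implicit Arguments.
Unset Strict Implicit.
Unset Printing Implicit Defensive.

Import Order.TTheory GRing.Theory Num.Theory.
Import numFieldNormedType.Exports.

Local Open Scope classical_set_scope.
Local Open Scope ring_scope.

Section asymptotic_order.
Context {R : realType}.
Implicit Types (a : nat -> \bar R) (b : nat -> R).

Definition asymp_le a b := (limn_esup (fun n => a n / (b n)%:E) < +oo)%E.

Definition asymp_ge a b := (0 < limn_einf (fun n => a n / (b n)%:E))%E.

End asymptotic_order.

(* The value of a density outside [0, 1] is irrelevant: every definition below
   only looks at its restriction to [0, 1]. *)
Record density (R : realType) := Density {
  density_fun :> R -> R;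
  density_measurable : measurable_fun (`[0, 1] : set R) density_fun;
  density_ge0 : forall x, x \in `[0, 1] -> 0 <= density_fun x;
  density_int1 :
    (\int[lebesgue_measure]_(x in `[0%R, 1%R]) (density_fun x)%:E = 1)%E }.

Section density_probability.
Context {R : realType} (f : density R).

Definition density_prob (A : set R) : \bar R :=
  (\int[lebesgue_measure]_(x in A `&` `[0%R, 1%R]) (f x)%:E)%E.

Let density_prob0 : density_prob set0 = 0%E.
Proof. by rewrite /density_prob set0I integral_set0. Qed.

Let density_prob_ge0 A : (0 <= density_prob A)%E.
Proof.
by apply: integral_ge0 => x [_ x01]; rewrite lee_fin density_ge0.
Qed.

Let density_prob_sigma_additive : semi_sigma_additive density_prob.
Proof.
move=> F mF tF mUF; rewrite /density_prob setI_bigcupl.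
apply: cvg_toP.
  apply: ereal_nondecreasing_is_cvgn => m n mn.
  apply: lee_sum_nneg_natr => // k _ _.
  by apply: integral_ge0 => x [_ x01]; rewrite lee_fin density_ge0.
rewrite ge0_integral_bigcup//=.
- by move=> k; exact: (measurableI _ _ (mF k)).
- apply/measurable_EFinP; apply: measurable_funS (density_measurable f) => //.
  by move=> x [k _ []].
- by move=> x [k _ [_ x01]]; rewrite lee_fin density_ge0.
- exact: trivIset_setIr.
Qed.

HB.instance Definition _ := isMeasure.Build _ _ _ density_prob
  density_prob0 density_prob_ge0 density_prob_sigma_additive.

Let density_prob_setT : density_prob setT = 1%E.
Proof. by rewrite /density_prob setTI density_int1. Qed.

HB.instance Definition _ :=
  Measure_isProbability.Build _ _ _ density_prob density_prob_setT.

End density_probability.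

Section product_law.
Context {d : measure_display} {T : measurableType d} {R : realType}.

Section product.
Context {d' : measure_display} {U : measurableType d'}.
Variables (P : probability T R) (Q : probability U R).

Definition prod_prob : set (T * U) -> \bar R := (P \x Q)%E.

HB.instance Definition _ := Measure.on prod_prob.

Let prod_prob_setT : prod_prob setT = 1%E.
Proof.
rewrite -setXTT [LHS]product_measure1E//.
rewrite -[RHS]mule1; congr (_ * _)%E; exact: probability_setT.
Qed.

HB.instance Definition _ :=
  Measure_isProbability.Build _ _ _ prod_prob prod_prob_setT.

End product.

Definition cons_pair n (x : T * n.-tuple T) : n.+1.-tuple T :=
  [tuple of x.1 :: x.2].

Let measurable_cons_pair n : measurable_fun setT (@cons_pair n).
Proof. exact: measurable_cons. Qed.

HB.instance Definition _ n :=
  isMeasurableFun.Build _ _ _ _ (@cons_pair n) (@measurable_cons_pair n).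

(* The joint law of n i.i.d. variables of law P; iid_lawE characterizes it. *)
Fixpoint iid_law (P : probability T R) n : probability (n.-tuple T) R :=
  match n with
  | 0 => \d_([tuple] : 0.-tuple T)
  | m.+1 => distribution (prod_prob P (iid_law P m)) (@cons_pair m)
  end.

Let measurable_box n (A : 'I_n -> set T) :
  (forall i, measurable (A i)) ->
  measurable [set t : n.-tuple T | forall i, A i (tnth t i)].
Proof.
move=> mA; rewrite (_ : [set t | _] =
    \big[setI/setT]_(i < n) ((@tnth n T ^~ i) @^-1` A i)); last first.
  apply/seteqP; split => [t tA|t].
    by elim/big_ind : _ => [|B1 B2 ? ?|i _]; [|split|exact: tA].
  by move=> tA i; move: tA; rewrite (bigD1 i)//= => -[].
apply: bigsetI_measurable => i _; rewrite -[X in measurable X]setTI.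
by apply: (@measurable_tnth _ T n i).
Qed.

Lemma iid_lawE (P : probability T R) n (A : 'I_n -> set T) :
  (forall i, measurable (A i)) ->
  iid_law P n [set t | forall i, A i (tnth t i)] = (\prod_(i < n) P (A i))%E.
Proof.
elim: n A => [|n IHn] A mA.
  by rewrite big_ord0 /= diracE mem_set// => -[].
pose A' (i : 'I_n) := A (lift ord0 i).
have mA' i : measurable (A' i) by exact: mA.
rewrite big_ord_recl -(IHn A')//.
have mB := @measurable_box n A' mA'.
rewrite -[RHS](product_measure1E P (iid_law P n) (mA ord0) mB).
congr (prod_prob _ _ _); apply/seteqP.
split=> [[x t] /= xtA|[x t] /= [xA tA] i].
  by split => [|i]; [have := xtA ord0|have := xtA (lift ord0 i); rewrite tnthS].
by case: (unliftP ord0 i) => [j ->|->//]; rewrite tnthS; exact: tA.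
Qed.

End product_law.

Section integral_functional.
Context {R : realType}.
Implicit Types (T h : R -> R) (f : density R).

Definition holder_ball (beta C : R) : set (R -> R) :=
  [set h | (forall x, x \in `[0, 1] -> `|h x| <= C) /\
           (forall x y, x \in `[0, 1] -> y \in `[0, 1] ->
              `|h x - h y| <= C * `|x - y| `^ beta)].

Definition holder_densities (Mlo Mhi C beta : R) : set (density R) :=
  [set f | holder_ball beta C f /\
           (forall x, x \in `[0, 1] -> Mlo <= f x <= Mhi)].

Definition phi T h : R := \int[lebesgue_measure]_(x in `[0, 1]) T (h x).

(* F is meant to be a convex set of densities. For F a Hoelder class this can
   hold although T is not affine on [Mlo, Mhi]: the Hoelder constant and the
   constraint of total mass 1 may keep the values of all densities in F away
   from the part of [Mlo, Mhi] where T is not affine, and phi T is then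
   constant on F. *)
Definition phi_affine_on (F : set (density R)) T :=
  forall f g, F f -> F g -> forall t : R, t \in `[0, 1] ->
    phi T (fun x => t * f x + (1 - t) * g x) =
    t * phi T f + (1 - t) * phi T g.

(* Two-sided differentiability at every point of [a, b], which loses no
   generality: a function on [a, b] with one-sided derivatives at a and b
   extends by its Taylor polynomials. *)
Definition bounded_third_derivative (a b : R) T :=
  (forall k x, (k < 3)%N -> x \in `[a, b] -> derivable (derive1n k T) x 1) /\
  (exists K : R, forall x, x \in `[a, b] -> `|derive1n 3 T x| <= K).

Definition affine_on (a b : R) T :=
  exists c0 c1 : R, forall x, x \in `[a, b] -> T x = c0 + c1 * x.

Definition risk T f n (est : n.-tuple R -> R) : \bar R :=
  ('E_(iid_law (density_prob f) n)[fun X => ((est X - phi T f) ^+ 2)%R])%E.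

Definition max_risk T (F : set (density R)) n (est : n.-tuple R -> R) :
    \bar R :=
  ereal_sup [set risk T f est | f in F].

(* At n = 0 and n = 1, where n ^ 2 / log n is meaningless, the value is a
   convention; only large n matter in asymp_le and asymp_ge. *)
Definition adaptive_rate (beta : R) (n : nat) : R :=
  (n%:R ^+ 2 / ln n%:R) `^ (- (4 * beta / (1 + 4 * beta))).

End integral_functional.

(* Main.v *)
Require Import Defs.
From mathcomp Require Import all_boot all_order all_algebra.
From mathcomp Require Import all_classical all_reals all_analysis.
From mathcomp Require Import measurable_realfun.
From mathcomp Require Import ring lra.
Import Order.TTheory GRing.Theory Num.Theory.
Import numFieldNormedType.Exports.
Local Open Scope classical_set_scope.
Local Open Scope ring_scope.

(** A constrained-risk argument.  As [phi T] is not affine on the Hoelder class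
    of order [beta_star], some density [f0] of that class takes on an interval
    values near a point where [T''] does not vanish.  There [f0] is perturbed
    by [k] mean-zero bumps of width [h ~ 1/k] and height [kappa * h ^ beta]
    with random signs; since [f0] is smoother than required, the perturbed
    densities stay in the class of order [beta].  Opposite sign vectors cancel
    the linear term, so that on average [phi T] moves by [~ h ^ (2 beta)], while
    the chi-square distance of the mixture of the [n]-fold products from that of
    [f0] is at most [exp (C kappa^4 n^2 h^(1 + 4 beta))].  Taking
    [h ^ (1 + 4 beta) ~ log n / n^2] makes this a power of [n], as small as one
    likes with [kappa].  The fast rate at [f0] gains a fixed power of [n], which
    beats it, so the estimator cannot follow the perturbation and its risk
    on the perturbed densities is at least of order [h ^ (4 beta)]. *)

(** The logarithm comes from the constrained-risk form of the argument. Comparing two hypotheses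
    usually needs a bounded chi-square distance, which would give [h ^ (1 + 4 beta) ~ n ^ (-2)].
    Here the risk at [f0] is below the squared separation by a power of [n], and a chi-square
    distance up to that ratio is still harmless; this buys the factor [log n]. A single sign vector
    would not do: its chi-square exponent is of order [n h ^ (2 beta)], far too large. Averaging
    over two independent sign vectors removes the part linear in [n], since inner products of
    perturbations have mean zero; what remains is [n ^ 2] times the sum over [k] cells of squares of
    order [h ^ (2 + 4 beta)]. The curvature of [T] has to be found at a value that some density of
    the class really takes, which is why the non-linearity of [phi T] on the class is the starting
    point. All that is derived from [f0], and [kappa] with it, is fixed before [n]; only the number
    of cells grows. *)

Set Implicit Arguments.
Unset Strict Implicit.
Unset Printing Implicit Defensive.

(** * Change of measure for product laws *)

Section density_change.
Import HBNNSimple.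

(* [X] will be the identity of [R], whose source and target carry two measurable
   structures with distinct displays. *)
Lemma ge0_integral_density d d' (T : measurableType d)
    (T' : measurableType d') (R : realType) (mu : {measure set T -> \bar R})
    (nu : {measure set T' -> \bar R}) (X : T -> T') (g : T -> R)
    (h : T' -> \bar R) :
  measurable_fun setT X -> measurable_fun setT g -> (forall x, 0 <= g x) ->
  (forall A, measurable A ->
    nu A = \int[mu]_(x in X @^-1` A) (g x)%:E)%E ->
  measurable_fun setT h -> (forall x, 0 <= h x)%E ->
  (\int[nu]_x h x = \int[mu]_x (h (X x) * (g x)%:E))%E.
Proof.
move=> mX mg g0 nuE mh h0.
have mgE : measurable_fun setT (EFin \o g) by exact/measurable_EFinP.
have mhX : measurable_fun setT (h \o X) by exact: measurableT_comp.
have mA (A : set T') : measurable A -> measurable_fun setT (fun x => \1_A (X x) : R).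
  by move=> mA; apply: (measurableT_comp (measurable_indic mA)).
pose h_ := nnsfun_approx measurableT mh.
have hE n : (\int[nu]_x (h_ n x)%:E = \int[mu]_x ((h_ n (X x))%:E * (g x)%:E))%E.
  rewrite integralT_nnsfun sintegralE.
  transitivity (\sum_(r \in range (h_ n))
      \int[mu]_x (r%:E * ((\1_(h_ n @^-1` [set r]) (X x))%:E * (g x)%:E)))%E.
    apply: eq_fsbigr => r; rewrite inE => -[y _ yr].
    have r0 : 0 <= r by rewrite -yr.
    rewrite ge0_integralZl//; last first.
    - by move=> x _; rewrite mule_ge0// lee_fin.
    - by apply: emeasurable_funM => //; apply/measurable_EFinP; exact: mA.
    rewrite nuE// integral_mkcond; congr (_ * _)%E; apply: eq_integral => x _.
    rewrite patchE indicE (_ : (x \in _) = (X x \in h_ n @^-1` [set r]))//.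
    by case: ifP; rewrite (mul1e, mul0e).
  rewrite -ge0_integral_fsum//.
  - apply: eq_integral => x _; rewrite [X in (X%:E * _)%E]fimfunE.
    rewrite -fsumEFin// ge0_mule_fsuml; last first.
      by move=> r; rewrite nnfun_muleindic_ge0.
    apply: eq_fsbigr => r _.
    by rewrite muleA EFinM.
  - move=> r; apply: emeasurable_funM => //; apply: emeasurable_funM => //.
    by apply/measurable_EFinP; exact: mA.
  - move=> r x _; rewrite muleA mule_ge0 ?nnfun_muleindic_ge0//.
    by rewrite lee_fin.
transitivity (limn (fun n => \int[nu]_x (h_ n x)%:E))%E.
  rewrite -monotone_convergence//=.
  - apply: eq_integral => ? /[!inE] xD; apply/esym/cvg_lim => //=.
    exact: cvg_nnsfun_approx.
  - by move=> n; exact/measurable_EFinP/measurable_funTS.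
  - by move=> n ? _; rewrite lee_fin.
  - by move=> ? _ ? ? mn; rewrite lee_fin; exact/lefP/nd_nnsfun_approx.
under eq_fun do rewrite hE.
rewrite -monotone_convergence//=.
- apply: eq_integral => x _; apply/cvg_lim => //=; apply: cvgeZr => //.
  exact: cvg_nnsfun_approx.
- move=> n; apply: emeasurable_funM => //; apply/measurable_EFinP.
  exact: measurableT_comp.
- by move=> n x _; rewrite mule_ge0// lee_fin.
- by move=> x _ m n mn; rewrite lee_wpmul2r// lee_fin//; exact/lefP/nd_nnsfun_approx.
Qed.

End density_change.

Section iid_change.
Context d (T : measurableType d) (R : realType).
Implicit Types (P Q : probability T R) (r : T -> R).

Lemma integral_iid_law_cst P n (c : R) :
  (\int[iid_law P n]_t c%:E = c%:E)%E.
Proof.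
rewrite integral_cst// -[RHS]mule1; congr (_ * _)%E.
exact: (@probability_setT _ _ _ (iid_law P n)).
Qed.

Lemma ge0_integral_iid_lawS P n (h : n.+1.-tuple T -> \bar R) :
  measurable_fun setT h -> (forall t, 0 <= h t)%E ->
  (\int[iid_law P n.+1]_t h t =
   \int[P]_x \int[iid_law P n]_t h (cons_pair (x, t)))%E.
Proof.
move=> mh h0.
have -> : (\int[iid_law P n.+1]_t h t =
    \int[P \x iid_law P n]_z h (cons_pair z))%E.
  exact: (@ge0_integral_distribution _ _ _ _ _
    (prod_prob P (iid_law P n)) (@cons_pair _ _ n)).
apply: (@fubini_tonelli1 _ _ _ _ _ P (iid_law P n) (h \o (@cons_pair _ _ n))).
- by apply: measurableT_comp.
- by move=> x /=.
Qed.

Lemma measurable_prod_tnth r n : measurable_fun setT r ->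
  measurable_fun setT (fun t : n.-tuple T => \prod_(i < n) r (tnth t i)).
Proof.
move=> mr; apply: measurable_prod => i _.
by apply: measurableT_comp => //; exact: measurable_tnth.
Qed.

Lemma prod_tnth_cons r n (x : T) (t : n.-tuple T) :
  \prod_(i < n.+1) r (tnth (cons_pair (x, t)) i) =
  r x * \prod_(i < n) r (tnth t i).
Proof.
by rewrite big_ord_recl tnth0; congr (_ * _); apply: eq_bigr => i _; rewrite tnthS.
Qed.

(** [r] is the likelihood ratio of [P] to [Q], known only through integrals of nonnegative
    functions. Tonelli changes one observation at a time. *)
Lemma ge0_integral_iid_change P Q r :
  measurable_fun setT r -> (forall x, 0 <= r x) ->
  (forall h : T -> \bar R, measurable_fun setT h -> (forall x, 0 <= h x)%E ->
    (\int[P]_x h x = \int[Q]_x (h x * (r x)%:E))%E) ->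
  forall n (h : n.-tuple T -> \bar R),
    measurable_fun setT h -> (forall t, 0 <= h t)%E ->
    (\int[iid_law P n]_t h t =
     \int[iid_law Q n]_t (h t * (\prod_(i < n) r (tnth t i))%:E))%E.
Proof.
move=> mr r0 PQ; elim=> [|n IHn] h mh h0.
  by apply: eq_integral => t _; rewrite big_ord0 mule1.
have mhc : measurable_fun setT (h \o @cons_pair _ _ n) by exact: measurableT_comp.
have mprod m := @measurable_prod_tnth r m mr.
have prod0 m (t : m.-tuple T) : 0 <= \prod_(i < m) r (tnth t i).
  by apply: prodr_ge0.
rewrite !ge0_integral_iid_lawS//; last first.
- by move=> t; rewrite mule_ge0// lee_fin.
- by apply: emeasurable_funM => //; apply/measurable_EFinP; exact: mprod.
have mhx x : measurable_fun setT (fun t => h (cons_pair (x, t))).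
  exact: (measurable_fun_pair2 (f := h \o @cons_pair _ _ n) x mhc).
rewrite PQ; first last.
- by move=> x; apply: integral_ge0.
- exact: (@measurable_fun_fubini_tonelli_F _ _ _ _ _ (iid_law P n) _ mhc
    (fun z => h0 (cons_pair z))).
apply: eq_integral => x _; rewrite IHn// muleC -ge0_integralZl//; first last.
- by rewrite lee_fin.
- by move=> t _; rewrite mule_ge0// lee_fin.
- by apply: emeasurable_funM => //; apply/measurable_EFinP; exact: mprod.
by apply: eq_integral => t _; rewrite prod_tnth_cons EFinM muleCA.
Qed.

(** Independent factors multiply in expectation. Taken with the product of two likelihood ratios,
    this turns their inner product for one observation into its [n]-th power. *)
Lemma ge0_integral_iid_prod Q r n (c : R) :
  measurable_fun setT r -> (forall x, 0 <= r x) ->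
  (\int[Q]_x (r x)%:E = c%:E)%E ->
  (\int[iid_law Q n]_t (\prod_(i < n) r (tnth t i))%:E = (c ^+ n)%:E)%E.
Proof.
move=> mr r0 rc.
have mrE : measurable_fun setT (EFin \o r) by exact/measurable_EFinP.
have prod0 m (t : m.-tuple T) : 0 <= \prod_(i < m) r (tnth t i).
  by apply: prodr_ge0.
elim: n => [|n IHn].
  under eq_integral do rewrite big_ord0.
  by rewrite integral_iid_law_cst.
rewrite ge0_integral_iid_lawS//; first last.
- by move=> t; rewrite lee_fin.
- by apply/measurable_EFinP; exact: measurable_prod_tnth.
transitivity (\int[Q]_x ((r x)%:E * (c ^+ n)%:E))%E.
  apply: eq_integral => x _; rewrite -IHn -ge0_integralZl//; first last.
  - by rewrite lee_fin.
  - by move=> t _; rewrite lee_fin.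
  - by apply/measurable_EFinP; exact: measurable_prod_tnth.
  by apply: eq_integral => t _; rewrite prod_tnth_cons.
have c0 : 0 <= c by rewrite -lee_fin -rc; apply: integral_ge0 => x _; rewrite lee_fin.
rewrite ge0_integralZr//.
- by rewrite rc -EFinM exprS.
- by move=> x _; rewrite lee_fin.
- by rewrite lee_fin exprn_ge0.
Qed.

End iid_change.

(** The quadratic form [a u^2 - u s + b s^2] has nonpositive discriminant. The weights stay free so
    that the two squares can be balanced at each use. *)
Lemma amgm_scaled (R : realFieldType) (u s a b : R) :
  0 <= b -> 4^-1 <= a * b -> u * s <= a * u ^+ 2 + b * s ^+ 2.
Proof.
move=> b0 ab.
have b_gt0 : 0 < b.
  by rewrite lt0r b0 andbT; apply: contraTneq ab => ->; rewrite mulr0 -ltNge.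
rewrite -(ler_pM2l b_gt0).
have -> : b * (a * u ^+ 2 + b * s ^+ 2) = a * b * u ^+ 2 + (b * s) ^+ 2 by ring.
have : 4^-1 * u ^+ 2 <= a * b * u ^+ 2 by rewrite ler_wpM2r// sqr_ge0.
have := sqr_ge0 (u / 2 - b * s).
nra.
Qed.

(** * A constrained-risk inequality for a finite mixture *)

Section constrained_risk.
Context d (T : measurableType d) (R : realType) (I : finType).
Variables (Q : probability T R) (P : I -> probability T R) (r : I -> T -> R).
Hypothesis mr : forall i, measurable_fun setT (r i).
Hypothesis r0 : forall i x, 0 <= r i x.
Hypothesis PQ : forall i (h : T -> \bar R), measurable_fun setT h ->
  (forall x, 0 <= h x)%E ->
  (\int[P i]_x h x = \int[Q]_x (h x * (r i x)%:E))%E.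
Variables (n : nat) (X : n.-tuple T -> R) (th0 : R) (th : I -> R).
Hypothesis mX : measurable_fun setT X.
Variable chi : I -> I -> R.
Hypothesis rr : forall i j, (\int[Q]_x (r i x * r j x)%:E = (chi i j)%:E)%E.

Let L i (t : n.-tuple T) := \prod_(k < n) r i (tnth t k).
(** Divided by [#|I|], this is the likelihood ratio of the uniform mixture of the product laws; its
    normalized second moment is one plus the chi-square distance. *)
Let S t := \sum_i L i t.

Let mL i : measurable_fun setT (L i).
Proof. exact: measurable_prod_tnth. Qed.

Let L0 i t : 0 <= L i t.
Proof. exact: prodr_ge0. Qed.

Let S0 t : 0 <= S t.
Proof. exact: sumr_ge0. Qed.

Let mS : measurable_fun setT S.
Proof. exact: measurable_sum. Qed.

Let mXB c : measurable_fun setT (fun t => X t - c).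
Proof. by apply: measurable_funB. Qed.

Let mXB2 c : measurable_fun setT (fun t => (X t - c) ^+ 2).
Proof. by apply: measurable_funX. Qed.

Let mXBn c : measurable_fun setT (fun t => `|X t - c|).
Proof. by apply: measurableT_comp. Qed.

Let integral_S2 :
  (\int[iid_law Q n]_t (S t ^+ 2)%:E = (\sum_i \sum_j chi i j ^+ n)%:E)%E.
Proof.
transitivity (\int[iid_law Q n]_t
    \sum_(p : I * I) (L p.1 t * L p.2 t)%:E)%E.
  apply: eq_integral => t _.
  by rewrite sumEFin expr2 /S big_distrlr pair_bigA.
rewrite ge0_integral_sum//; first last.
- by move=> p t _; rewrite lee_fin mulr_ge0.
- by move=> p; apply/measurable_EFinP; exact: measurable_funM.
rewrite pair_bigA -sumEFin; apply: eq_bigr => -[i j] _ /=.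
rewrite -(ge0_integral_iid_prod n _ _ (rr i j))//.
- by apply: eq_integral => t _; rewrite /L -big_split.
- exact: measurable_funM.
- by move=> x; exact: mulr_ge0.
Qed.

(* Pointwise AM-GM replaces Cauchy-Schwarz, so that only integrals of nonnegative
   functions occur and no integrability has to be known. *)
Lemma constrained_risk_lower_bound (rho e K D : R) :
  0 < D -> 0 < K -> (0 < #|I|)%N ->
  D * #|I|%:R <= \sum_i `|th i - th0| ->
  \sum_i \sum_j chi i j ^+ n <= K * #|I|%:R ^+ 2 ->
  (\int[iid_law Q n]_t ((X t - th0) ^+ 2)%:E <= e%:E)%E ->
  16 * e * K <= D ^+ 2 ->
  (forall i, \int[iid_law (P i) n]_t ((X t - th i) ^+ 2)%:E <= rho%:E)%E ->
  D ^+ 2 / 2 <= rho.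
Proof.
move=> D0 K0 I0 Dth chiK riskQ eK riskP.
have N0 : 0 < #|I|%:R :> R by rewrite ltr0n.
set N : R := #|I|%:R in N0 Dth chiK *.
pose J i := (\int[iid_law Q n]_t (`|X t - th0| * L i t)%:E)%E.
(* Triangle inequality through [X] under [P i]: the distance to [th i] costs at most
   [D / 4 + rho / D] by AM-GM, and the distance to [th0] is moved to [Q], the law for which the risk
   bound [e] is given. *)
have thJ i : (`|th i - th0|%:E <= (D / 4 + rho / D)%:E + J i)%E.
  have PJ : (\int[iid_law (P i) n]_t `|X t - th0|%:E = J i)%E.
    apply: (ge0_integral_iid_change (mr i) (r0 i) (PQ i)).
      by apply/measurable_EFinP; exact: mXBn.
    by move=> t; rewrite lee_fin.
  have -> : (`|th i - th0|%:E =
      \int[iid_law (P i) n]_t (`|th i - th0|%:E))%E.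
    by rewrite integral_iid_law_cst.
  apply: (@le_trans _ _ (\int[iid_law (P i) n]_t
     (((D / 4)%:E + D^-1%:E * ((X t - th i) ^+ 2)%:E) + `|X t - th0|%:E))%E).
    apply: ge0_le_integral => //.
    - apply: emeasurable_funD; last by apply/measurable_EFinP; exact: mXBn.
      apply: emeasurable_funD => //; apply: emeasurable_funM => //.
      by apply/measurable_EFinP; exact: mXB2.
    - move=> t _; rewrite -EFinM -!EFinD lee_fin.
      have -> : th i - th0 = - (X t - th i) + (X t - th0) by ring.
      apply: (le_trans (ler_normD _ _)); rewrite normrN lerD2r.
      have := @amgm_scaled R (`|X t - th i|) 1 D^-1 (D / 4).
      rewrite mulr1 expr1n mulr1 real_normK ?num_real// (addrC (D / 4)); apply.
        by rewrite divr_ge0// ltW.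
      by rewrite mulrA mulVf ?mul1r// gt_eqF.
  rewrite ge0_integralD//; first last.
  - by apply/measurable_EFinP; exact: mXBn.
  - apply: emeasurable_funD => //; apply: emeasurable_funM => //.
    by apply/measurable_EFinP; exact: mXB2.
  - move=> t _; rewrite -EFinM -EFinD lee_fin addr_ge0//.
      by rewrite divr_ge0// ltW.
    by rewrite mulr_ge0 ?sqr_ge0// invr_ge0 ltW.
  rewrite PJ; apply: leeD => //.
  rewrite ge0_integralD//; first last.
  - apply: emeasurable_funM => //; apply/measurable_EFinP; exact: mXB2.
  - by move=> t _; rewrite -EFinM lee_fin mulr_ge0 ?sqr_ge0// invr_ge0 ltW.
  - by move=> t _; rewrite lee_fin divr_ge0// ltW.
  rewrite integral_iid_law_cst EFinD; apply: leeD => //.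
  rewrite ge0_integralZl//; first last.
  - by rewrite lee_fin invr_ge0 ltW.
  - by move=> t _; rewrite lee_fin sqr_ge0.
  - by apply/measurable_EFinP; exact: mXB2.
  rewrite mulrC EFinM; apply: lee_wpmul2l; last exact: riskP.
  by rewrite lee_fin invr_ge0 ltW.
have sumJ : (\sum_i J i <= (N * (D / 4))%:E)%E.
  rewrite -ge0_integral_sum//; first last.
  - by move=> j t _; rewrite lee_fin mulr_ge0.
  - by move=> j; apply/measurable_EFinP; apply: measurable_funM => //; exact: mXBn.
  (* Here [a * b = 1 / 4], and each of the two terms becomes at most [N * (D / 8)]: the first by
     [16 * e * K <= D ^+ 2], the second by the bound on the second moment of [S]. *)
  pose a := N * (2 * K / D); pose b := D / (8 * K * N).
  have a0 : 0 <= a by rewrite !mulr_ge0 ?invr_ge0 ?ltW.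
  have b0 : 0 <= b by rewrite divr_ge0 ?ltW// !mulr_gt0.
  apply: (@le_trans _ _ (\int[iid_law Q n]_t
     (a%:E * ((X t - th0) ^+ 2)%:E + b%:E * (S t ^+ 2)%:E))%E).
    apply: ge0_le_integral => //.
    - by move=> t _; apply: sume_ge0 => j _; rewrite lee_fin mulr_ge0.
    - apply: emeasurable_sum => j.
      by apply/measurable_EFinP; apply: measurable_funM => //; exact: mXBn.
    - apply: emeasurable_funD; apply: emeasurable_funM => //.
        by apply/measurable_EFinP; exact: mXB2.
      by apply/measurable_EFinP; exact: measurable_funX.
    - move=> t _; rewrite sumEFin -mulr_sumr -!EFinM -EFinD lee_fin.
      rewrite -/(S t) -(@real_normK _ (X t - th0)) ?num_real//; apply: amgm_scaled => //.
      rewrite /a /b le_eqVlt; apply/orP; left; apply/eqP; field.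
      by rewrite !gt_eqF.
  rewrite ge0_integralD//; first last.
  - by apply: emeasurable_funM => //; apply/measurable_EFinP; exact: measurable_funX.
  - by move=> t _; rewrite -EFinM lee_fin mulr_ge0 ?sqr_ge0.
  - by apply: emeasurable_funM => //; apply/measurable_EFinP; exact: mXB2.
  - by move=> t _; rewrite -EFinM lee_fin mulr_ge0 ?sqr_ge0.
  rewrite !ge0_integralZl//; first last.
  - by move=> t _; rewrite lee_fin sqr_ge0.
  - by apply/measurable_EFinP; exact: mXB2.
  - by move=> t _; rewrite lee_fin sqr_ge0.
  - by apply/measurable_EFinP; exact: measurable_funX.
  rewrite integral_S2 -EFinM.
  apply: (@le_trans _ _ (a%:E * e%:E + (b * (K * N ^+ 2))%:E)%E).
    apply: leeD; first by apply: lee_wpmul2l => //; rewrite lee_fin.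
    by rewrite lee_fin ler_wpM2l.
  rewrite -EFinM -EFinD lee_fin.
  have -> : b * (K * N ^+ 2) = N * (D / 8).
    by rewrite /b; field; rewrite !gt_eqF.
  have -> : D / 4 = D / 8 + D / 8 by field.
  rewrite mulrDr lerD2r /a -(mulrA N) ler_wpM2l ?(ltW N0)//.
  have -> : 2 * K / D * e = 16 * e * K / (8 * D) by field; rewrite gt_eqF.
  have -> : D / 8 = D ^+ 2 / (8 * D) by field; rewrite gt_eqF.
  by rewrite ler_wpM2r// invr_ge0 mulr_ge0 ?ltW.
(* Averaged over [i], the losses [D / 4] under the [P i] and [D / 4] under [Q] leave half of [D],
   which [rho / D] must cover. *)
have : ((D * N)%:E <= (N * (D / 2 + rho / D))%:E)%E.
  apply: (@le_trans _ _ (\sum_i ((D / 4 + rho / D)%:E + J i))%E).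
    apply: (@le_trans _ _ (\sum_i `|th i - th0|)%:E); first by rewrite lee_fin.
    by rewrite -sumEFin; apply: lee_sum => j _; exact: thJ.
  rewrite big_split/=.
  apply: (@le_trans _ _
      ((N * (D / 4 + rho / D))%:E + (N * (D / 4))%:E)%E).
    apply: leeD => //.
    by rewrite sumEFin lee_fin sumr_const mulr_natl.
  by rewrite -EFinD lee_fin le_eqVlt; apply/orP; left; apply/eqP; field; rewrite gt_eqF.
rewrite lee_fin mulrC ler_pM2l// => DN.
have : D / 2 <= rho / D by lra.
by rewrite ler_pdivlMr// expr2 mulrAC.
Qed.

End constrained_risk.

(** * Likelihood ratios of densities on the unit interval *)

Section density_ratio.
Context {R : realType}.
Implicit Types f g : density R.

Lemma ge0_integral_density_prob f (h : R -> \bar R) :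
  measurable_fun setT h -> (forall x, 0 <= h x)%E ->
  (\int[density_prob f]_x h x =
   \int[lebesgue_measure]_x (h x * ((f \_ `[0, 1]) x)%:E))%E.
Proof.
move=> mh h0.
apply: (@ge0_integral_density _ _ (measurableTypeR R) _ R lebesgue_measure
  (density_prob f) idfun (f \_ `[0, 1])) => //.
- by move=> _ A mA; rewrite setTI.
- by apply/(measurable_restrictT _ _).1 => //; exact: density_measurable.
- move=> x; rewrite patchE; case: ifPn => // /[!inE] x01; exact: density_ge0.
- move=> A mA; rewrite [LHS]integral_mkcondr; apply: eq_integral => x _.
  by rewrite !patchE; case: ifP.
Qed.

(** Cut to zero outside [[0, 1]], where nothing is known about [f] and [g], so that it is measurable
    and nonnegative on the whole line, as the change of measure asks. *)
Definition density_ratio f g : R -> R := (fun x => f x / g x) \_ `[0, 1].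

Variable g : density R.
Hypothesis g_gt0 : forall x, x \in `[0, 1] -> 0 < g x.

Lemma measurable_density_quot (u : R -> R) :
  measurable_fun (`[0, 1] : set R) u ->
  measurable_fun (`[0, 1] : set R) (fun x => u x / g x).
Proof.
move=> mu.
(* Positivity of [g] turns the inverse into a real power, which is a measurable function of
   [g x]. *)
apply: (eq_measurable_fun (fun x => u x * g x `^ (-1))).
  by move=> x /[!inE] x01; rewrite powR_inv1// ltW// g_gt0.
apply: measurable_funM => //.
by apply: (measurableT_comp (measurable_powR _)); exact: density_measurable.
Qed.

Lemma measurable_density_ratio f : measurable_fun setT (density_ratio f g).
Proof.
apply/(measurable_restrictT _ _).1 => //; apply: measurable_density_quot.
exact: density_measurable.
Qed.

Lemma density_ratio_ge0 f x : 0 <= density_ratio f g x.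
Proof.
rewrite /density_ratio patchE; case: ifPn => // /[!inE] x01.
by rewrite divr_ge0// ?density_ge0// ltW// g_gt0.
Qed.

Lemma ge0_integral_density_ratio f (h : R -> \bar R) :
  measurable_fun setT h -> (forall x, 0 <= h x)%E ->
  (\int[density_prob f]_x h x =
   \int[density_prob g]_x (h x * (density_ratio f g x)%:E))%E.
Proof.
move=> mh h0; rewrite !ge0_integral_density_prob//; first last.
- by move=> x; rewrite mule_ge0// lee_fin density_ratio_ge0.
- apply: emeasurable_funM => //; apply/measurable_EFinP.
  exact: measurable_density_ratio.
apply: eq_integral => x _; rewrite -muleA -EFinM /density_ratio !patchE.
case: ifPn => [/[!inE] x01|_]; last by rewrite mulr0.
by rewrite divfK// gt_eqF// g_gt0.
Qed.

Lemma integral_density_ratioM f1 f2 :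
  (\int[density_prob g]_x (density_ratio f1 g x * density_ratio f2 g x)%:E =
   \int[lebesgue_measure]_(x in `[0%R, 1%R]) (f1 x * f2 x / g x)%:E)%E.
Proof.
rewrite ge0_integral_density_prob//; first last.
- by move=> x; rewrite lee_fin mulr_ge0// density_ratio_ge0.
- apply/measurable_EFinP; apply: measurable_funM;
  exact: measurable_density_ratio.
rewrite [RHS]integral_mkcond; apply: eq_integral => x _.
rewrite -EFinM /density_ratio !patchE.
case: ifPn => [/[!inE] x01|_]; last by rewrite mulr0.
congr (_%:E); rewrite -!mulrA; congr (_ * _).
by rewrite mulrC mulrA mulfVK ?mulrA 1?mulrC// gt_eqF// g_gt0.
Qed.

End density_ratio.

(** * Bumps and perturbed densities *)

Section bump.
Context {R : realType}.
Implicit Types (u v x p h beta : R).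

(** A cubic that is odd about [1 / 2], hence of mean zero, and that vanishes at both ends, so that
    its extension by zero is Lipschitz. *)
Definition bump : R -> R := (fun u => u * (1 - u) * (1 - 2 * u)) \_ `[0, 1].

Lemma bumpE u : 0 <= u <= 1 -> bump u = u * (1 - u) * (1 - 2 * u).
Proof. by move=> u01; rewrite /bump patchE mem_set//= in_itv. Qed.

Lemma bump_out u : ~~ (0 < u < 1) -> bump u = 0.
Proof.
move=> u01; have [u01'|uN] := boolP (0 <= u <= 1); last first.
  by rewrite /bump patchE memNset//= in_itv; exact/negP.
move: u01; rewrite negb_and -!leNgt => /orP[u0|u1].
  have -> : u = 0 by lra.
  by rewrite bumpE ?lexx ?ler01// !mul0r.
have -> : u = 1 by lra.
by rewrite bumpE ?lexx ?ler01// subrr mulr0 mul0r.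
Qed.

Lemma measurable_bump : measurable_fun setT bump.
Proof.
apply/(measurable_restrictT _ _).1 => //.
apply: measurable_funTS; apply: measurable_funM.
  by apply: measurable_funM => //; exact: measurable_funB.
by apply: measurable_funB => //; exact: measurable_funM.
Qed.

(** The right-hand side is the distance from [u] to the complement of the unit interval: this is the
    Lipschitz bound against a point outside the support. *)
Lemma bump_le u : `|bump u| <= Num.max 0 (Num.min u (1 - u)).
Proof.
have [/andP[u0 u1]|/bump_out ->] := boolP (0 < u < 1); last first.
  by rewrite normr0 le_max lexx.
rewrite bumpE; last by rewrite !ltW.
have h1 : 0 < u * (1 - u) by rewrite mulr_gt0// subr_gt0.
apply: (@le_trans _ _ (u * (1 - u))).
  rewrite normrM (ger0_norm (ltW h1)) ger_pMr// ler_norml.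
  by apply/andP; split; lra.
by rewrite le_max le_min; apply/orP; right; apply/andP; split; nra.
Qed.

Lemma bump_half u : `|bump u| <= 2^-1.
Proof.
apply: (le_trans (bump_le u)); rewrite ge_max ge_min invr_ge0 ler0n/=.
by have [//|u2] := leP u 2^-1; lra.
Qed.

Lemma bump_lipschitz u v : `|bump u - bump v| <= `|u - v|.
Proof.
wlog uv : u v / u <= v.
  move=> H; have [/H//|/ltW/H] := leP u v.
  by rewrite distrC (distrC v).
have [u01|uN] := boolP (0 <= u <= 1); last first.
  rewrite [X in X - _]bump_out; last by lra.
  rewrite sub0r normrN; apply: (le_trans (bump_le v)).
  by rewrite distrC ger0_norm ?subr_ge0// ge_max ge_min; lra.
have [v01|vN] := boolP (0 <= v <= 1); last first.
  rewrite [X in _ - X]bump_out; last by lra.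
  rewrite subr0; apply: (le_trans (bump_le u)).
  by rewrite distrC ger0_norm ?subr_ge0// ge_max ge_min; lra.
rewrite !bumpE//.
(* The first factor on the right is the divided difference of the cubic. It equals
   [3/2 (u + v - 1)^2 + 1/2 (u - v)^2 - 1/2], so it is at least [-1/2]; the products prepared below
   give the upper bound [1]. *)
have -> : u * (1 - u) * (1 - 2 * u) - v * (1 - v) * (1 - 2 * v) =
  (1 - 3 * (u + v) + 2 * (u ^+ 2 + u * v + v ^+ 2)) * (u - v) by ring.
rewrite normrM -[X in _ <= X]mul1r ler_wpM2r// ler_norml.
have /andP[u0 u1] := u01; have /andP[v0 v1] := v01.
have uv0 := mulr_ge0 u0 v0; have uv1 := sqr_ge0 (u + v - 1).
have uv2 : 0 <= u * (1 - u) by rewrite mulr_ge0 ?subr_ge0.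
have uv3 : 0 <= v * (1 - v) by rewrite mulr_ge0 ?subr_ge0.
have uv4 := sqr_ge0 (u - v).
by apply/andP; split; nra.
Qed.

(** The constant is [1] for every order: up to distance [1] the Lipschitz bound is the stronger one,
    and beyond it twice the sup bound [1 / 2] suffices. *)
Lemma bump_holder beta u v : 0 < beta -> beta <= 1 ->
  `|bump u - bump v| <= `|u - v| `^ beta.
Proof.
move=> b0 b1; have [uv1|uv1] := leP `|u - v| 1.
  apply: (le_trans (bump_lipschitz u v)).
  have [->|uv0] := eqVneq `|u - v| 0; first by rewrite powR_ge0.
  rewrite -[X in X <= _]powRr1//; apply: ger_powR => //.
  by rewrite uv1 andbT lt0r uv0 normr_ge0.
apply: (@le_trans _ _ 1).
  apply: (le_trans (ler_normB _ _)).
  by rewrite [leRHS](splitr 1) lerD// div1r bump_half.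
by rewrite -(powRr0 `|u - v|); apply: ler_powR; rewrite ltW.
Qed.

(** A crude lower bound on the middle half of the positive lobe, [1/8 <= u <= 3/8]: there
    [u (1 - u) >= 5/64] and [1 - 2 u >= 1/4]. *)
Definition bump_min : R := 5 / 256.

Lemma bump_min_itv : 0 < bump_min <= 1.
Proof. by rewrite /bump_min; apply/andP; split; lra. Qed.

Lemma bump_ge u : 8^-1 <= u <= 3 / 8 -> bump_min <= bump u.
Proof.
move=> /andP[u0 u1]; rewrite bumpE; last by lra.
have a1 : 5 / 64 <= u * (1 - u) by nra.
have a2 : 1 / 4 <= 1 - 2 * u by lra.
have -> : bump_min = (5 / 64) * (1 / 4) by rewrite /bump_min; lra.
by apply: ler_pM => //; lra.
Qed.

End bump.

Arguments bump_min R : clear implicits.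

Lemma bump_min_gt0 (R : realType) : 0 < bump_min R.
Proof. by have /andP[] := @bump_min_itv R. Qed.

Section unit_interval.
Context {R : realType}.
Local Notation mu := (@lebesgue_measure R).
Local Notation D := (`[0%R, 1%R]%classic : set R).

Lemma lebesgue_measure01 : mu D = 1%E.
Proof. by rewrite lebesgue_measure_itv/= lte_fin ltr01 oppr0 adde0. Qed.

Lemma integrable01 (M : R) (u : R -> R) :
  measurable_fun D u -> (forall x, x \in `[0, 1] -> `|u x| <= M) ->
  mu.-integrable D (EFin \o u).
Proof.
move=> mu_ uM; apply: measurable_bounded_integrable => //.
  by rewrite [ltLHS]lebesgue_measure01 ltry.
exists M; split; first exact: num_real.
by move=> N MN x /= x01; apply: (le_trans (uM _ x01)); exact: ltW.
Qed.

Lemma Rintegral_deriv_poly (q : {poly R}) (a b : R) : a < b ->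
  \int[mu]_(x in `[a, b]) (q^`()).[x] = q.[b] - q.[a].
Proof.
move=> ab; rewrite /Rintegral (@continuous_FTC2 _ _ (horner q))//.
- by apply: continuous_subspaceT => x; exact: continuous_horner.
- split.
  + by move=> x _; exact: derivable_horner.
  + by apply: cvg_at_right_filter; exact: continuous_horner.
  + by apply: cvg_at_left_filter; exact: continuous_horner.
- by move=> x _; rewrite derive1E; have [_ ->] := is_derive_poly q x.
Qed.

Section cell.
Variables (p h : R).
Hypothesis h_gt0 : 0 < h.
Hypothesis p_ge0 : 0 <= p.
Hypothesis ph_le1 : p + h <= 1.

Definition cell_bump (x : R) := bump ((x - p) / h).

Lemma measurable_cell_bump (A : set R) : measurable_fun A cell_bump.
Proof.
apply: measurable_funTS; apply: (measurableT_comp measurable_bump).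
by apply: measurable_funM => //; exact: measurable_funB.
Qed.

Lemma cell_itv x : (0 < (x - p) / h < 1) = (p < x < p + h).
Proof.
by rewrite pmulr_lgt0 ?invr_gt0// subr_gt0 ltr_pdivrMr// mul1r ltrBlDl.
Qed.

Lemma cell_bump_out x : ~~ (p < x < p + h) -> cell_bump x = 0.
Proof. by rewrite -cell_itv => /bump_out. Qed.

Lemma cell_bump_holder beta x y : 0 < beta -> beta <= 1 ->
  `|cell_bump x - cell_bump y| <= (`|x - y| / h) `^ beta.
Proof.
move=> b0 b1; apply: (le_trans (bump_holder _ _ b0 b1)).
by rewrite -mulrBl opprB addrA subrK normrM normfV (gtr0_norm h_gt0).
Qed.

Lemma Rintegral_cell_bump : \int[mu]_(x in D) cell_bump x = 0.
Proof.
(* [q] is an antiderivative of the bump, vanishing at both ends. *)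
pose q : {poly R} := (2 * h ^+ 3)^-1 *:
  (('X - p%:P) * ('X - p%:P) * (('X - (p + h)%:P) * ('X - (p + h)%:P))).
have qE x : (q^`()).[x] = ((x - p) / h) * (1 - (x - p) / h) * (1 - 2 * ((x - p) / h)).
  rewrite /q derivZ !derivM !derivXsubC !(mulr1, mul1r).
  rewrite !(hornerZ, hornerD, hornerM, hornerN, hornerX, hornerC); field.
  by rewrite gt_eqF.
rewrite Rintegral_mkcond.
transitivity (\int[mu]_(x in `[p, p + h]) (q^`()).[x]).
  rewrite [RHS]Rintegral_mkcond; apply: eq_Rintegral => x _.
  rewrite !patchE; have [xph|xph] := boolP (p < x < p + h).
    have /andP[x0 x1] := xph.
    rewrite !mem_set/= ?in_itv/= ?(ltW x0) ?(ltW x1) ?(le_trans p_ge0 (ltW x0))//.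
      move: xph; rewrite -cell_itv => /andP[u0 u1].
      by rewrite qE /cell_bump bumpE ?(ltW u0) ?(ltW u1).
    by rewrite (le_trans (ltW x1)).
  rewrite cell_bump_out// if_same.
  case: ifPn => // /[!inE] /=; rewrite in_itv/= => xph'.
  have [->|->] : x = p \/ x = p + h.
    move: xph; rewrite negb_and -!leNgt => /orP[] xp; [left|right]; lra.
  - by rewrite qE subrr !mul0r.
  - by rewrite qE addrAC subrr add0r mulfV ?gt_eqF// subrr mulr0 mul0r.
rewrite Rintegral_deriv_poly ?ltrDl// /q.
rewrite !(hornerZ, hornerD, hornerM, hornerN, hornerX, hornerC).
by rewrite !subrr !(mulr0, mul0r) subrr.
Qed.

Lemma cell_bump_le1 x : `|cell_bump x| <= 1.
Proof. by apply: (le_trans (bump_half _)); rewrite invf_le1// ler1n. Qed.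

Lemma Rintegral_cell_bump_sqr :
  h / 4 * bump_min R ^+ 2 <= \int[mu]_(x in D) cell_bump x ^+ 2.
Proof.
pose G := (`[p + h / 8, p + 3 / 8 * h]%classic : set R).
have mG : mu G = (h / 4)%:E.
  rewrite lebesgue_measure_itv/= lte_fin ltrD2l ifT; last by move: h_gt0; lra.
  by rewrite -EFinB; congr (_%:E); lra.
have GD : G `<=` D.
  move=> x; rewrite /G/= !in_itv/= => /andP[xl xr].
  have hp := h_gt0; have pp := p_ge0; have ph := ph_le1.
  by apply/andP; split; lra.
have mGs : measurable G by exact: measurable_itv.
have mGf : measurable_fun D (\1_G : R -> R).
  by apply: measurable_funTS; exact: (measurable_indic mGs).
have -> : h / 4 * bump_min R ^+ 2 =
    \int[mu]_(x in D) (bump_min R ^+ 2 * \1_G x) :> R.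
  rewrite RintegralZl//; last first.
    apply: (@integrable01 1) => // x _.
    by rewrite indicE; case: (_ \in _); rewrite ?normr1 ?normr0.
  rewrite mulrC; congr (_ * _).
  rewrite /Rintegral integral_indic// setIidl//.
  by rewrite [X in fine X]mG.
apply: le_Rintegral => //.
- apply: (@integrable01 1) => //.
    by apply: measurable_funM.
  move=> x _; rewrite indicE; case: (_ \in _); rewrite ?mulr0 ?normr0// mulr1.
  have /andP[m0 m1] := @bump_min_itv R.
  by rewrite ger0_norm ?sqr_ge0// exprn_ile1// ltW.
- apply: (@integrable01 1) => //.
    by apply: measurable_funX; exact: measurable_cell_bump.
  by move=> x _; rewrite normrX; apply: exprn_ile1 => //; exact: cell_bump_le1.
- move=> x x01; rewrite indicE; case: (boolP (x \in G)) => [|_]; last first.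
    by rewrite mulr0 sqr_ge0.
  rewrite inE /G/= in_itv/= mulr1 => /andP[xl xr].
  have cge : bump_min R <= cell_bump x.
    have hp := h_gt0; apply: bump_ge; rewrite ler_pdivlMr// ler_pdivrMr//.
    by apply/andP; split; lra.
  have c0 : 0 <= bump_min R by exact: ltW (bump_min_gt0 R).
  by rewrite ler_sqr ?nnegrE// (le_trans c0 cge).
Qed.


End cell.

End unit_interval.

Section perturbation.
Context {R : realType}.
Local Notation mu := (@lebesgue_measure R).
Local Notation D := (`[0%R, 1%R]%classic : set R).

Lemma EFin_Rintegral01 (u : R -> R) : mu.-integrable D (EFin \o u) ->
  (\int[mu]_(x in D) (u x)%:E = (\int[mu]_(x in D) u x)%:E)%E.
Proof.
by move=> iu; rewrite /Rintegral fineK//; exact: integrable_fin_num.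
Qed.

Lemma Rintegral01_sum (I : finType) (u : I -> R -> R) :
  (forall i, mu.-integrable D (EFin \o u i)) ->
  \int[mu]_(x in D) \sum_i u i x = \sum_i \int[mu]_(x in D) u i x.
Proof.
move=> iu; rewrite /Rintegral.
under eq_integral do rewrite -sumEFin.
rewrite integral_sum//=; under eq_bigr do rewrite EFin_Rintegral01//.
by rewrite sumEFin.
Qed.

Lemma integrable_density (f : density R) : mu.-integrable D (EFin \o f).
Proof.
apply/integrableP; split.
  by apply/measurable_EFinP; exact: density_measurable.
rewrite (_ : (\int[mu]_(x in D) _ = 1)%E) ?ltry// -(density_int1 f).
by apply: eq_integral => x /[!inE] x01; rewrite /= ger0_norm// density_ge0.
Qed.

Variables (x0 h a : R) (k : nat).
Hypotheses (h_gt0 : 0 < h) (x0_ge0 : 0 <= x0) (k_gt0 : (0 < k)%N).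
Hypothesis x0kh : x0 + k%:R * h <= 1.
Implicit Types (s t : {ffun 'I_k -> bool}) (x y : R) (i j : 'I_k).

Definition cell_start j := x0 + j%:R * h.
Local Notation psi j := (cell_bump (cell_start j) h).

Definition perturbation s x := \sum_j a * (-1) ^+ s j * psi j x.

Lemma cell_start_ge0 j : 0 <= cell_start j.
Proof. by rewrite addr_ge0// mulr_ge0// ltW. Qed.

Lemma cell_end_le j : cell_start j + h <= x0 + k%:R * h.
Proof.
rewrite /cell_start -addrA lerD2l -[X in _ + X]mul1r -mulrDl ler_pM2r//.
by rewrite natr1 ler_nat.
Qed.

Lemma cell_end_le1 j : cell_start j + h <= 1.
Proof. exact: le_trans (cell_end_le j) x0kh. Qed.

Lemma cell_disjoint i j x : i != j -> psi i x != 0 -> psi j x = 0.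
Proof.
move=> ij pi; have xi : cell_start i < x < cell_start i + h.
  by apply: contraNT pi => /cell_bump_out ->.
apply: (cell_bump_out h_gt0); apply/negP => xj.
clear pi; wlog lij : i j ij xi xj / (i < j)%N => [H|].
  have [ltij|ltji|/val_inj eij] := ltngtP i j.
  - exact: (H i j).
  - by apply: (H j i) => //; rewrite eq_sym.
  - by rewrite eij eqxx in ij.
suff : cell_start i + h <= cell_start j.
  move=> le_ij; move/andP: xi => [_ xi]; move/andP: xj => [xj _].
  by have := lt_trans xj xi; rewrite ltNge le_ij.
rewrite /cell_start -addrA lerD2l -[X in _ + X]mul1r -mulrDl ler_pM2r//.
by rewrite natr1 ler_nat.
Qed.

(** The cells are disjoint, so pointwise facts about a perturbation reduce to one bump. Where no
    bump is active any index serves, and [k_gt0] provides one. *)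
Lemma active_cell x : exists i, forall j, j != i -> psi j x = 0.
Proof.
have [i pi|p0] := pickP (fun j => psi j x != 0).
  by exists i => j ji; apply: (@cell_disjoint i) => //; rewrite eq_sym.
by exists (Ordinal k_gt0) => j _; apply/eqP; move: (p0 j) => /negbFE.
Qed.

Lemma perturbation_active s x i : (forall j, j != i -> psi j x = 0) ->
  perturbation s x = a * (-1) ^+ s i * psi i x.
Proof.
by move=> xi; rewrite /perturbation (bigD1 i)//= big1 ?addr0// => j /xi ->; rewrite mulr0.
Qed.

Lemma perturbation_le s x : `|perturbation s x| <= `|a|.
Proof.
have [i xi] := active_cell x; rewrite (perturbation_active _ xi).
by rewrite !normrM normr_sign mulr1 ler_piMr// cell_bump_le1.
Qed.

Lemma perturbationM s t x : perturbation s x * perturbation t x =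
  a ^+ 2 * \sum_j (-1) ^+ s j * (-1) ^+ t j * psi j x ^+ 2.
Proof.
have [i xi] := active_cell x; rewrite !(perturbation_active _ xi).
rewrite (bigD1 i)//= big1 ?addr0//; first by ring.
by move=> j /xi ->; rewrite expr0n mulr0.
Qed.

Lemma perturbation_out s x : ~~ (x0 < x < x0 + k%:R * h) -> perturbation s x = 0.
Proof.
move=> xN; rewrite /perturbation big1// => j _.
rewrite cell_bump_out ?mulr0//; apply: contra xN => /andP[xl xr].
rewrite (lt_le_trans xr (cell_end_le j)) andbT (le_lt_trans _ xl)//.
by rewrite lerDl mulr_ge0// ltW.
Qed.

Lemma perturbation_neg s x :
  perturbation [ffun j => ~~ s j] x = - perturbation s x.
Proof.
rewrite /perturbation -sumrN; apply: eq_bigr => j _.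
by rewrite ffunE signrN mulrN mulNr.
Qed.

(** If [x] and [y] belong to different cells, the bump of each cell vanishes at the other point, and
    the difference splits into increments of two single bumps. This is the factor [2], whatever the
    number of cells. *)
Lemma perturbation_holder beta s x y : 0 < beta -> beta <= 1 ->
  `|perturbation s x - perturbation s y| <=
  2 * `|a| * (`|x - y| / h) `^ beta.
Proof.
move=> b0 b1; set B := _ `^ beta.
have B0 : 0 <= B by exact: powR_ge0.
have psiB j : `|psi j x - psi j y| <= B by exact: cell_bump_holder.
have [i xi] := active_cell x; have [j yj] := active_cell y.
rewrite (perturbation_active _ xi) (perturbation_active _ yj).
have aB l z z' : `|psi l z - psi l z'| <= B ->
    `|a * (-1) ^+ s l * (psi l z - psi l z')| <= `|a| * B.
  by move=> lB; rewrite !normrM normr_sign mulr1 ler_wpM2l.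
have [<-|ij] := eqVneq i j.
  rewrite -mulrBr; apply: (le_trans (aB _ _ _ (psiB i))).
  by rewrite ler_wpM2r// ler_peMl// ler1n.
have -> : a * (-1) ^+ s i * psi i x - a * (-1) ^+ s j * psi j y =
  a * (-1) ^+ s i * (psi i x - psi i y) + a * (-1) ^+ s j * (psi j x - psi j y).
  by rewrite (yj _ ij) (xi j) 1?eq_sym// subr0 sub0r mulrN.
apply: (le_trans (ler_normD _ _)).
have -> : 2 * `|a| * B = `|a| * B + `|a| * B by ring.
by rewrite lerD// aB.
Qed.

Lemma measurable_perturbation (A : set R) s : measurable_fun A (perturbation s).
Proof.
apply: measurable_sum => j.
by apply: measurable_funM => //; exact: measurable_cell_bump.
Qed.

Lemma integrable_cell_bump j : mu.-integrable D (EFin \o psi j).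
Proof.
apply: (@integrable01 _ 1); first exact: measurable_cell_bump.
by move=> x _; exact: cell_bump_le1.
Qed.

Lemma integrable_perturbation s : mu.-integrable D (EFin \o perturbation s).
Proof.
apply: (@integrable01 _ `|a|); first exact: measurable_perturbation.
by move=> x _; exact: perturbation_le.
Qed.

Lemma Rintegral_perturbation s : \int[mu]_(x in D) perturbation s x = 0.
Proof.
rewrite Rintegral01_sum => [|j]; last exact: integrableZl (integrable_cell_bump j).
rewrite big1// => j _; rewrite RintegralZl//; last exact: integrable_cell_bump.
by rewrite Rintegral_cell_bump ?mulr0 ?cell_start_ge0 ?cell_end_le1.
Qed.

Lemma integrable_cell_bump_sqr j : mu.-integrable D (EFin \o (fun x => psi j x ^+ 2)).
Proof.
apply: (@integrable01 _ 1).
  by apply: measurable_funX; exact: measurable_cell_bump.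
by move=> x _; rewrite normrX; apply: exprn_ile1 => //; exact: cell_bump_le1.
Qed.

Lemma Rintegral_perturbation_sqr s :
  a ^+ 2 * (k%:R * (h / 4 * bump_min R ^+ 2)) <=
  \int[mu]_(x in D) perturbation s x ^+ 2.
Proof.
have -> : \int[mu]_(x in D) perturbation s x ^+ 2 =
    \int[mu]_(x in D) \sum_j a ^+ 2 * psi j x ^+ 2.
  apply: eq_Rintegral => x _; rewrite expr2 perturbationM mulr_sumr.
  by apply: eq_bigr => j _; rewrite -expr2 sqrr_sign mul1r.
rewrite Rintegral01_sum => [|j]; last exact: integrableZl (integrable_cell_bump_sqr j).
have -> : k%:R * (h / 4 * bump_min R ^+ 2) =
    \sum_(j < k) (h / 4 * bump_min R ^+ 2) :> R.
  by rewrite sumr_const card_ord mulr_natl.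
rewrite mulr_sumr.
apply: ler_sum => j _; rewrite RintegralZl//; last exact: integrable_cell_bump_sqr.
rewrite ler_wpM2l ?sqr_ge0// Rintegral_cell_bump_sqr ?cell_start_ge0//.
exact: cell_end_le1.
Qed.

Section against_density.
Variables (f : density R) (m : R).
Hypotheses (m_gt0 : 0 < m) (f_ge : forall x, x \in `[0, 1] -> m <= f x).

Let f_gt0 x : x \in `[0, 1] -> 0 < f x.
Proof. by move=> /f_ge; exact: lt_le_trans. Qed.

(** The squared norm of a bump in [L^2] with weight [1 / f]. As the bumps have disjoint supports,
    the chi-square form of the perturbations is diagonal with these entries, up to [a ^+ 2]. *)
Definition cell_weight j : R := \int[mu]_(x in D) (psi j x ^+ 2 / f x).

Lemma integrable_cell_weight j :
  mu.-integrable D (EFin \o (fun x => psi j x ^+ 2 / f x)).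
Proof.
apply: (@integrable01 _ m^-1).
  apply: measurable_density_quot => //.
  by apply: measurable_funX; exact: measurable_cell_bump.
move=> x x01; rewrite normrM normfV (gtr0_norm (f_gt0 x01)) -[leRHS]mul1r.
apply: ler_pM; rewrite ?invr_ge0 ?(ltW (f_gt0 _))//.
  by rewrite normrX; apply: exprn_ile1 => //; exact: cell_bump_le1.
by rewrite lef_pV2 ?posrE ?f_gt0// f_ge.
Qed.

Lemma cell_weight_ge0 j : 0 <= cell_weight j.
Proof.
apply: Rintegral_ge0 => x x01.
by rewrite divr_ge0 ?sqr_ge0// ltW// f_gt0.
Qed.

Lemma cell_weight_le j : cell_weight j <= h / m.
Proof.
pose G := (`[cell_start j, cell_start j + h]%classic : set R).
have mG : mu G = h%:E.
  rewrite lebesgue_measure_itv/= lte_fin ltrDl h_gt0.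
  by rewrite -EFinB addrAC subrr add0r.
have GD : G `<=` D.
  move=> x; rewrite /G/= !in_itv/= => /andP[xl xr].
  by rewrite (le_trans (cell_start_ge0 j) xl) (le_trans xr (cell_end_le1 j)).
have mGs : measurable G by exact: measurable_itv.
have mGf : measurable_fun D (\1_G : R -> R).
  by apply: measurable_funTS; exact: (measurable_indic mGs).
have -> : h / m = \int[mu]_(x in D) (m^-1 * \1_G x) :> R.
  rewrite RintegralZl//; last first.
    apply: (@integrable01 _ 1) => // x _.
    by rewrite indicE; case: (_ \in _); rewrite ?normr1 ?normr0.
  rewrite mulrC; congr (_ * _).
  rewrite /Rintegral integral_indic// setIidl//.
  by rewrite [X in fine X]mG.
apply: le_Rintegral => //.
- exact: integrable_cell_weight.
- apply: (@integrable01 _ m^-1); first exact: measurable_funM.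
  move=> x _; rewrite indicE; case: (_ \in _); rewrite ?mulr0 ?normr0 ?mulr1.
    by rewrite gtr0_norm ?invr_gt0.
  by rewrite invr_ge0 ltW.
move=> x x01; rewrite indicE; have [xG|xG] := boolP (x \in G).
  rewrite mulrC; apply: ler_pM; rewrite ?sqr_ge0 ?invr_ge0 ?(ltW (f_gt0 _))//.
    by rewrite lef_pV2 ?posrE ?f_gt0// f_ge.
  rewrite -[leLHS]ger0_norm ?sqr_ge0// normrX.
  by apply: exprn_ile1 => //; exact: cell_bump_le1.
rewrite cell_bump_out ?expr0n ?mul0r ?mulr0//.
apply: contra xG => /andP[xl xr]; rewrite inE /G/= in_itv/=.
by rewrite !ltW.
Qed.

Hypothesis a_le : `|a| <= m.

Definition perturbed_fun s x := f x + perturbation s x.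

Let measurable_perturbed s : measurable_fun D (perturbed_fun s).
Proof.
apply: measurable_funD; first exact: density_measurable.
exact: measurable_perturbation.
Qed.

Let perturbed_ge0 s x : x \in `[0, 1] -> 0 <= perturbed_fun s x.
Proof.
move=> x01; rewrite /perturbed_fun.
have := perturbation_le s x; rewrite ler_norml => /andP[+ _].
by have := f_ge x01; move: a_le; lra.
Qed.

Let perturbed_int1 s :
  (\int[mu]_(x in D) (perturbed_fun s x)%:E = 1)%E.
Proof.
have ip := integrable_perturbation s.
under eq_integral do rewrite EFinD.
rewrite integralD//; last exact: integrable_density.
by rewrite density_int1 EFin_Rintegral01// Rintegral_perturbation adde0.
Qed.

Definition perturbed_density s : density R :=
  Density (@measurable_perturbed s) (@perturbed_ge0 s) (perturbed_int1 s).

(** Expanding the product leaves [f], the two perturbations, which integrate to zero, and their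
    product over [f], in which only the diagonal terms survive. *)
Lemma perturbed_density_chi2 s t :
  (\int[mu]_(x in D)
     (perturbed_density s x * perturbed_density t x / f x)%:E =
   (1 + a ^+ 2 * \sum_j (-1) ^+ s j * (-1) ^+ t j * cell_weight j)%:E)%E.
Proof.
have mq : measurable_fun D (fun x => perturbation s x * perturbation t x / f x).
  apply: measurable_density_quot => //.
  by apply: measurable_funM; exact: measurable_perturbation.
have iq : mu.-integrable D
    (EFin \o (fun x => perturbation s x * perturbation t x / f x)).
  apply: (@integrable01 _ (m * m / m)) => // x x01.
  rewrite !normrM normfV (gtr0_norm (f_gt0 x01)).
  apply: ler_pM; rewrite ?mulr_ge0 ?invr_ge0 ?(ltW (f_gt0 _))//.
    by apply: ler_pM => //; apply: (le_trans (perturbation_le _ _)).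
  by rewrite lef_pV2 ?posrE ?f_gt0// f_ge.
have isum := integrable_perturbation s.
have itum := integrable_perturbation t.
have ifu := integrable_density f.
transitivity (\int[mu]_(x in D) ((f x)%:E + (perturbation s x)%:E +
   ((perturbation t x)%:E + (perturbation s x * perturbation t x / f x)%:E)))%E.
  apply: eq_integral => x /[!inE] x01; rewrite -!EFinD; congr (_%:E).
  rewrite /= /perturbed_fun; field.
  by rewrite gt_eqF// f_gt0.
rewrite integralD//; last 2 first.
- exact: integrableD.
- exact: integrableD.
rewrite integralD// integralD// density_int1 !EFin_Rintegral01//.
rewrite !Rintegral_perturbation adde0 add0e -EFinD; congr (_ + _)%:E.
transitivity (\int[mu]_(x in D) \sum_j
   (a ^+ 2 * ((-1) ^+ s j * (-1) ^+ t j)) * (psi j x ^+ 2 / f x)).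
  apply: eq_Rintegral => x _; rewrite perturbationM -mulrA mulr_suml mulr_sumr.
  by apply: eq_bigr => j _; rewrite !mulrA.
rewrite Rintegral01_sum => [|j]; last exact: integrableZl (integrable_cell_weight j).
rewrite mulr_sumr; apply: eq_bigr => j _.
by rewrite RintegralZl ?mulrA//; exact: integrable_cell_weight.
Qed.

End against_density.

End perturbation.

(** * Exponential moments of random signs *)

Section random_signs.
Context {R : realType}.

(** A crude subgaussian bound on [cosh]. For [y >= 1/2] already [y <= 2 y^2]; below that,
    [expR y <= 1 / (1 - y)] gives [cosh y <= 1 / (1 - y^2) <= 1 + 2 y^2]. *)
Lemma expRD_expRN_le (y : R) : expR y + expR (- y) <= 2 * expR (2 * y ^+ 2).
Proof.
wlog y0 : y / 0 <= y => [H|].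
  have [/H//|/ltW y0] := leP 0 y.
  by have := H (- y); rewrite oppr_ge0 opprK sqrrN addrC; exact.
have [y2|y2] := leP 2^-1 y.
  have yy : y <= 2 * y ^+ 2 by nra.
  have -> : 2 * expR (2 * y ^+ 2) = expR (2 * y ^+ 2) + expR (2 * y ^+ 2) by ring.
  by rewrite lerD// ler_expR//; lra.
have e1 : expR y <= (1 - y)^-1.
  rewrite -[y]opprK expRN opprK lef_pV2 ?posrE ?expR_gt0//; last by lra.
  by have := expR_ge1Dx (- y); lra.
have e2 : expR (- y) <= (1 + y)^-1.
  rewrite expRN lef_pV2 ?posrE ?expR_gt0//; last by lra.
  by have := expR_ge1Dx y; lra.
have e3 : 1 + 2 * y ^+ 2 <= expR (2 * y ^+ 2) by exact: expR_ge1Dx.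
apply: (le_trans (lerD e1 e2)); apply: (@le_trans _ _ (2 * (1 + 2 * y ^+ 2))); last first.
  by rewrite ler_pM2l.
have -> : (1 - y)^-1 + (1 + y)^-1 = 2 / (1 - y ^+ 2).
  by field; apply/and3P; split; rewrite gt_eqF//; nra.
rewrite ler_pdivrMr; last by nra.
have : y ^+ 2 <= 4^-1 by nra.
by have := sqr_ge0 y; nra.
Qed.

(** For fixed [s], [(1 + y) ^ n <= exp (n y)] makes each summand a product over cells, so the sum
    over [t] factors into terms [2 cosh (n z_j)]. The hypothesis [0 <= 1 + y] is what allows raising
    [1 + y <= exp y] to the power [n]. *)
Lemma sum_signs_chi2 (k n : nat) (z : 'I_k -> R) :
  (forall s t : {ffun 'I_k -> bool},
     0 <= 1 + \sum_j (-1) ^+ s j * (-1) ^+ t j * z j) ->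
  \sum_(s : {ffun 'I_k -> bool}) \sum_(t : {ffun 'I_k -> bool})
    (1 + \sum_j (-1) ^+ s j * (-1) ^+ t j * z j) ^+ n <=
  expR (2 * n%:R ^+ 2 * \sum_j z j ^+ 2) * #|{ffun 'I_k -> bool}|%:R ^+ 2.
Proof.
move=> ge0.
have bound (s : {ffun 'I_k -> bool}) : \sum_(t : {ffun 'I_k -> bool})
    (1 + \sum_j (-1) ^+ s j * (-1) ^+ t j * z j) ^+ n <=
    expR (2 * n%:R ^+ 2 * \sum_j z j ^+ 2) * #|{ffun 'I_k -> bool}|%:R.
  apply: (@le_trans _ _ (\sum_(t : {ffun 'I_k -> bool})
      \prod_j expR ((-1) ^+ s j * (-1) ^+ t j * (n%:R * z j)))).
    apply: ler_sum => t _.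
    rewrite -expR_sum.
    have -> : \sum_j (-1) ^+ s j * (-1) ^+ t j * (n%:R * z j) =
        (\sum_j (-1) ^+ s j * (-1) ^+ t j * z j) * n%:R.
      rewrite mulr_suml; apply: eq_bigr => j _; ring.
    rewrite expRM_natr lerXn2r ?nnegrE ?expR_ge0//.
    exact: expR_ge1Dx.
  rewrite -(bigA_distr_bigA (fun (j : 'I_k) (b : bool) =>
     expR ((-1) ^+ s j * (-1) ^+ b * (n%:R * z j)))) /=.
  apply: (@le_trans _ _ (\prod_j (2 * expR (2 * (n%:R * z j) ^+ 2)))).
    apply: ler_prod => j _; rewrite big_bool/= addr_ge0 ?expR_ge0//=.
    case: (s j); rewrite !(expr0, expr1) ?mulrNN ?mul1r ?mulN1r ?mulNr ?opprK ?mul1r.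
      exact: expRD_expRN_le.
    by rewrite addrC; exact: expRD_expRN_le.
  rewrite big_split/= prodr_const -expR_sum mulrC card_ffun card_bool natrX.
  rewrite ler_wpM2r ?exprn_ge0// ler_expR mulr_sumr.
  by apply: ler_sum => j _; rewrite exprMn mulrA.
apply: (le_trans (ler_sum _ (fun s _ => bound s))).
by rewrite sumr_const -[leLHS]mulr_natr -(mulrA (expR _)) -expr2; exact: lexx.
Qed.

End random_signs.

(** * Curvature of the functional *)

Section curvature.
Context {R : realType}.
Implicit Types (T U : R -> R) (a b c u v w x y t : R).

Lemma is_derive_derive1 U x : derivable U x 1 -> is_derive x (1:R) U (U^`()%classic x).
Proof. by move=> dU; rewrite derive1E; exact: DeriveDef. Qed.

Lemma MVT_sub U U1 a b u v : u < v -> a <= u -> v <= b ->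
  (forall x, a <= x <= b -> is_derive x (1:R) U (U1 x)) ->
  exists2 z, u < z < v & U v - U u = U1 z * (v - u).
Proof.
move=> uv au vb dU.
have dU' x : u <= x <= v -> is_derive x (1:R) U (U1 x).
  move=> /andP[ux xv]; apply: dU.
  by rewrite (le_trans au ux) (le_trans xv vb).
have [x xuv||z zuv Uz] := @MVT R U U1 u v uv.
- by apply: dU'; move: xuv; rewrite in_itv/= => /andP[? ?]; rewrite !ltW.
- by apply: derivable_within_continuous => x; rewrite in_itv/= => /dU' [].
by move: zuv; rewrite in_itv/=; exists z.
Qed.

Lemma second_difference_ge U U1 U2 a b c v h :
  (forall x, a <= x <= b -> is_derive x (1:R) U (U1 x)) ->
  (forall x, a <= x <= b -> is_derive x (1:R) U1 (U2 x)) ->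
  (forall x, a <= x <= b -> c <= U2 x) ->
  a <= v - `|h| -> v + `|h| <= b ->
  c * h ^+ 2 <= U (v + h) + U (v - h) - 2 * U v.
Proof.
move=> dU ddU Uc; wlog h0 : h / 0 <= h => [H|].
  have [/H//|/ltW h0] := leP 0 h => avh vhb.
  have := H (- h); rewrite oppr_ge0 normrN opprK sqrrN => /(_ h0 avh vhb).
  by rewrite (addrC (U (v - h))).
rewrite ger0_norm// => avh vhb.
have [->|hN0] := eqVneq h 0; first by rewrite expr0n/= mulr0 addr0 subr0; lra.
have {hN0}h_gt0 : 0 < h by rewrite lt0r hN0.
(* [V] has a nondecreasing derivative. *)
pose V := fun x => U x - c / 2 * (x * x).
have dV x : a <= x <= b -> is_derive x (1:R) V (U1 x - c * x).
  move=> xab; have dUx := dU x xab.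
  have dsq : is_derive x (1 : R) (fun y => c / 2 * (y * y)) (c * x).
    have : is_derive x (1:R) (cst (c / 2) * (id * id)) (c * x).
      apply: is_derive_eq; rewrite scaler0 addr0 /=.
      change (c / 2 * (x * 1 + x * 1) = c * x); lra.
    by [].
  exact: is_deriveB.
have mono x y : a <= x -> x < y -> y <= b -> U1 x - c * x <= U1 y - c * y.
  move=> ax xy yb; have [z /andP[xz zy] Uz] := MVT_sub xy ax yb ddU.
  have : c * (y - x) <= U2 z * (y - x).
    rewrite ler_pM2r ?subr_gt0//; apply: Uc.
    by rewrite (le_trans ax (ltW xz)) (le_trans (ltW zy) yb).
  by rewrite -Uz; lra.
have [|||z1 /andP[z1l z1r] V1] := @MVT_sub V _ a b (v - h) v _ _ _ dV; try lra.
have [|||z2 /andP[z2l z2r] V2] := @MVT_sub V _ a b v (v + h) _ _ _ dV; try lra.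
have : V v - V (v - h) <= V (v + h) - V v.
  rewrite V1 V2 opprB [v + (h - v)]addrCA subrr addr0 [v + h - v]addrAC subrr add0r.
  by rewrite ler_pM2r//; apply: mono; lra.
rewrite /V; lra.
Qed.

(** If the graph of [T] leaves the chord at the intermediate point, the mean slopes on its two sides
    differ, so [T1] differs at two interior points and [T2] is nonzero somewhere between them. That
    point is written as a convex combination so that a mixture of two densities with the same weight
    takes it as a value. *)
Lemma exists_curved_value T T1 T2 a b u v t :
  (forall x, a <= x <= b -> is_derive x (1:R) T (T1 x)) ->
  (forall x, a <= x <= b -> is_derive x (1:R) T1 (T2 x)) ->
  a <= u <= b -> a <= v <= b -> 0 <= t <= 1 ->
  T (t * u + (1 - t) * v) != t * T u + (1 - t) * T v ->
  u != v /\ exists s, 0 < s < 1 /\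
    T2 (s * u + (1 - s) * v) != 0.
Proof.
move=> dT ddT; wlog uv : u v t / u <= v => [H|].
  have [/H//|/ltW vu uab vab t01 tuv] := leP u v; first exact.
  have [||||vNu [s [/andP[s0 s1] Ts]]] := H v u (1 - t) vu => //.
  - by move: t01 => /andP[? ?]; apply/andP; split; lra.
  - by rewrite subKr addrC [X in _ != X]addrC.
  rewrite eq_sym; split => //; exists (1 - s); split.
    by apply/andP; split; lra.
  by rewrite subKr addrC.
move=> /andP[au ub] /andP[av vb] /andP[t0 t1] tuv.
have uNv : u != v.
  apply: contraNneq tuv => <-; apply/eqP.
  have -> : t * u + (1 - t) * u = u by ring.
  by ring.
split => //.
have {uv}uv : u < v by rewrite lt_neqAle uNv.
have tN0 : t != 0.
  apply: contraNneq tuv => ->; apply/eqP.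
  by rewrite !mul0r !subr0 !mul1r !add0r.
have tN1 : t != 1.
  apply: contraNneq tuv => ->; apply/eqP.
  by rewrite !subrr !mul0r !mul1r !addr0.
have {t0}t0 : 0 < t by rewrite lt0r tN0.
have {t1}t1 : t < 1 by rewrite lt_neqAle tN1.
set z := t * u + (1 - t) * v in tuv.
have uz : u < z by rewrite /z; nra.
have zv : z < v by rewrite /z; nra.
have [||c1 /andP[c1l c1r] TE1] := MVT_sub uz _ _ dT; try lra.
have [||c2 /andP[c2l c2r] TE2] := MVT_sub zv _ _ dT; try lra.
have T12 : T1 c2 - T1 c1 != 0.
  apply: contraNneq tuv => /eqP; rewrite subr_eq0 => /eqP T12.
  rewrite T12 in TE2.
  have e1 : z - u = (1 - t) * (v - u) by rewrite /z; ring.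
  have e2 : v - z = t * (v - u) by rewrite /z; ring.
  rewrite e1 in TE1; rewrite e2 in TE2.
  apply/eqP.
  have -> : T u = T z - T1 c1 * ((1 - t) * (v - u)) by rewrite -TE1; ring.
  have -> : T v = T z + T1 c1 * (t * (v - u)) by rewrite -TE2; ring.
  ring.
have c12 : c1 < c2 by lra.
have [||c3 /andP[c3l c3r] TE3] := MVT_sub c12 _ _ ddT; try lra.
have vu : v - u != 0 by rewrite gt_eqF// subr_gt0.
exists ((v - c3) / (v - u)); split.
  rewrite divr_gt0 ?subr_gt0// ?ltr_pdivrMr ?subr_gt0 ?mul1r//; last by lra.
  by lra.
have -> : (v - c3) / (v - u) * u + (1 - (v - c3) / (v - u)) * v = c3.
  by field.
by apply: contraNneq T12 => c30; rewrite TE3 c30 mul0r.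
Qed.

(** [sg] is the sign of [T2 w], so that convex and concave [T] are treated alike. The centre [v]
    varies because the base density is not constant; the inclusion in [[a, b]] will keep the
    perturbed densities between their bounds. *)
Lemma curvature_nbhd T T1 T2 a b w :
  (forall x, a <= x <= b -> is_derive x (1:R) T (T1 x)) ->
  (forall x, a <= x <= b -> is_derive x (1:R) T1 (T2 x)) ->
  {for w, continuous T2} -> a < w < b -> T2 w != 0 ->
  exists sg c rho : R, [/\ `|sg| = 1, 0 < c, 0 < rho &
    forall v h, `|v - w| <= rho -> `|h| <= rho -> a <= v + h <= b /\
      c * h ^+ 2 <= sg * (T (v + h) + T (v - h) - 2 * T v)].
Proof.
move=> dT ddT cT2 /andP[aw wb] Tw.
have Tw2 : 0 < `|T2 w| / 2 by rewrite divr_gt0// normr_gt0.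
have [e /= e0 eT] : \forall y \near w, `|T2 w - T2 y| < `|T2 w| / 2.
  by have /cvgrPdist_lt := cT2; exact.
(* Both [v] and [h] move by up to [rho], so [T] is evaluated within [2 * rho] of [w]. There [T2]
   must keep half its size, and the points must stay in [[a, b]]. *)
pose rho := Num.min (e / 4) (Num.min ((w - a) / 2) ((b - w) / 2)).
have rho0 : 0 < rho by rewrite !lt_min !divr_gt0 ?subr_gt0.
have [r1 r2 r3] : [/\ rho <= e / 4, rho <= (w - a) / 2 & rho <= (b - w) / 2].
  by rewrite /rho !ge_min !lexx !orbT; split.
pose sg := Num.sg (T2 w).
have sg1 : `|sg| = 1 by rewrite normr_sg Tw.
have T2sg y : w - 2 * rho <= y <= w + 2 * rho -> `|T2 w| / 2 <= sg * T2 y.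
  move=> /andP[y1 y2]; have : `|T2 w - T2 y| < `|T2 w| / 2.
    apply: eT; rewrite /= (@le_lt_trans _ _ (2 * rho))//; last by lra.
    by rewrite ler_norml; apply/andP; split; lra.
  rewrite /sg; have [T0|Tp|Tn] := sgrP (T2 w).
  - by rewrite T0 eqxx in Tw.
  - by rewrite mul1r ltr_norml => /andP[? ?]; lra.
  - by rewrite mulN1r ltr_norml => /andP[? ?]; lra.
have sub x : w - 2 * rho <= x <= w + 2 * rho -> a <= x <= b.
  by move=> /andP[? ?]; apply/andP; split; lra.
exists sg, (`|T2 w| / 2), rho; split => // v h.
move=> vw hr; move: (vw) (hr); rewrite !ler_norml => /andP[v1 v2] /andP[h1 h2]; split.
  by apply/andP; split; lra.
have -> : sg * (T (v + h) + T (v - h) - 2 * T v) =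
  sg * T (v + h) + sg * T (v - h) - 2 * (sg * T v) by ring.
apply: (@second_difference_ge (fun y => sg * T y) (fun y => sg * T1 y)
  (fun y => sg * T2 y) (w - 2 * rho) (w + 2 * rho)) => //.
- by move=> x /sub /dT dTx; exact: (is_deriveZ sg).
- by move=> x /sub /ddT dTx; exact: (is_deriveZ sg).
- by lra.
- by lra.
Qed.

End curvature.

(** * A base density through a curved value *)

Section base_density.
Context {R : realType}.
Local Notation mu := (@lebesgue_measure R).
Local Notation D := (`[0%R, 1%R]%classic : set R).

Section mixture.
Variables (f g : density R) (t : R).
Hypothesis t01 : 0 <= t <= 1.

Definition mixture_fun x := t * f x + (1 - t) * g x.

Let measurable_mixture : measurable_fun D mixture_fun.
Proof.
by apply: measurable_funD; apply: measurable_funM => //; exact: density_measurable.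
Qed.

Let mixture_ge0 x : x \in `[0, 1] -> 0 <= mixture_fun x.
Proof.
move=> x01; have /andP[t0 t1] := t01.
by rewrite addr_ge0// mulr_ge0 ?subr_ge0 ?density_ge0.
Qed.

Let mixture_int1 : (\int[mu]_(x in D) (mixture_fun x)%:E = 1)%E.
Proof.
have /andP[t0 t1] := t01.
have intE (h : density R) : \int[mu]_(x in D) h x = 1.
  by rewrite /Rintegral density_int1.
have fi : mu.-integrable D (EFin \o (fun x => t * f x)).
  exact: integrableZl (integrable_density f).
have gi : mu.-integrable D (EFin \o (fun x => (1 - t) * g x)).
  exact: integrableZl (integrable_density g).
rewrite EFin_Rintegral01; last by apply: (integrableD _ fi gi).
congr (_%:E); rewrite RintegralD//.
rewrite !RintegralZl//; try exact: integrable_density.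
rewrite !intE; ring.
Qed.

Definition mixture : density R :=
  Density measurable_mixture mixture_ge0 mixture_int1.

End mixture.

Lemma mixture_holder (Mlo Mhi C beta : R) (f g : density R) (t : R)
    (t01 : 0 <= t <= 1) :
  holder_densities Mlo Mhi C beta f -> holder_densities Mlo Mhi C beta g ->
  holder_densities Mlo Mhi C beta (mixture f g t01).
Proof.
have /andP[t0 t1] := t01; have s0 : 0 <= 1 - t by rewrite subr_ge0.
have avg (A B c : R) : A <= c -> B <= c -> t * A + (1 - t) * B <= c.
  move=> Ac Bc; have -> : c = t * c + (1 - t) * c by ring.
  by rewrite lerD// ler_wpM2l.
have avg' (A B c : R) : c <= A -> c <= B -> c <= t * A + (1 - t) * B.
  move=> Ac Bc; have -> : c = t * c + (1 - t) * c by ring.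
  by rewrite lerD// ler_wpM2l.
have norm_avg (A B c : R) : `|A| <= c -> `|B| <= c -> `|t * A + (1 - t) * B| <= c.
  move=> Ac Bc; apply: (le_trans (ler_normD _ _)).
  by rewrite !normrM (ger0_norm t0) (ger0_norm s0) avg.
move=> [[fC fH] fM] [[gC gH] gM]; split; first split.
- by move=> x x01; apply: norm_avg; [exact: fC|exact: gC].
- move=> x y x01 y01; rewrite /= /mixture_fun.
  have -> : t * f x + (1 - t) * g x - (t * f y + (1 - t) * g y) =
    t * (f x - f y) + (1 - t) * (g x - g y) by ring.
  by apply: norm_avg; [exact: fH|exact: gH].
- move=> x x01; have /andP[f1 f2] := fM x x01; have /andP[g1 g2] := gM x x01.
  by rewrite /= /mixture_fun avg ?avg'.
Qed.

Section values_in_interval.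
Variables (T T1 : R -> R) (a b : R).
Hypothesis ab : a <= b.
Hypothesis dT : forall x, a <= x <= b -> is_derive x (1:R) T (T1 x).

Let cT : {within `[a, b], continuous T}.
Proof.
by apply: derivable_within_continuous => x; rewrite in_itv/= => /dT [].
Qed.

Lemma integrable_comp (u : R -> R) : measurable_fun D u ->
  (forall x, x \in `[0, 1] -> a <= u x <= b) ->
  mu.-integrable D (EFin \o (T \o u)).
Proof.
move=> mu_ uab.
have [cmax _ Tmax] := EVT_max ab cT; have [cmin _ Tmin] := EVT_min ab cT.
apply: (@integrable01 _ (`|T cmax| + `|T cmin|)).
  apply: (measurable_comp (F := `[a, b]%classic)) => //.
  - by move=> _ [x x01 <-]; rewrite /= in_itv/=; exact: uab.
  - exact: subspace_continuous_measurable_fun.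
move=> x x01; have uxab : u x \in `[a, b] by rewrite in_itv/= uab.
have h1 := Tmax _ uxab; have h2 := Tmin _ uxab.
have h3 := ler_norm (T cmax); have h4 := ler_norm (- T cmin).
rewrite normrN in h4.
have h5 := normr_ge0 (T cmax); have h6 := normr_ge0 (T cmin).
by rewrite ler_norml /=; apply/andP; split; lra.
Qed.

End values_in_interval.

(** By contraposition and pointwise: where the affine identity fails for [T] at the values [f x] and
    [g x], some mixture of [f] and [g], again in the class by convexity, takes a curved value at
    [x]. This value lies strictly between [f x] and [g x], hence strictly inside the bounds. *)
Lemma exists_curved_density (Mlo Mhi C beta : R) (T T1 T2 : R -> R) :
  Mlo <= Mhi ->
  (forall x, Mlo <= x <= Mhi -> is_derive x (1:R) T (T1 x)) ->
  (forall x, Mlo <= x <= Mhi -> is_derive x (1:R) T1 (T2 x)) ->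
  ~ phi_affine_on (holder_densities Mlo Mhi C beta) T ->
  exists f x, [/\ holder_densities Mlo Mhi C beta f, x \in `[0, 1],
    Mlo < f x < Mhi & T2 (f x) != 0].
Proof.
move=> Mle dT ddT nonlin; apply: contrapT => H; apply: nonlin => f g Ff Fg t.
rewrite in_itv/= => t01.
have intT (h : density R) : holder_densities Mlo Mhi C beta h ->
    mu.-integrable D (EFin \o (T \o h)).
  by case=> _ hM; apply: (integrable_comp Mle dT) => //; exact: density_measurable.
rewrite /phi -!RintegralZl//; try exact: intT.
rewrite -RintegralD//; last 2 first.
- exact: integrableZl (intT _ Ff).
- exact: integrableZl (intT _ Fg).
apply: eq_Rintegral => x /[!inE] x01; apply/eqP/negPn/negP => Tx.
have [fx gx] := (Ff.2 x x01, Fg.2 x x01).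
have [fNg [s [s01 Ts]]] := exists_curved_value dT ddT fx gx t01 Tx.
have /andP[s0 s1] := s01.
have s01' : 0 <= s <= 1 by rewrite !ltW.
apply: H; exists (mixture f g s01'), x; split => //.
- exact: mixture_holder.
- move: fx gx => /andP[f1 f2] /andP[g1 g2]; rewrite /= /mixture_fun.
  have t0 : 0 < 1 - s by rewrite subr_gt0.
  move: fNg; rewrite neq_lt => /orP[]; rewrite -subr_gt0 => lt.
    have := mulr_gt0 s0 lt; have := mulr_gt0 t0 lt => p1 p2.
    by apply/andP; split; lra.
  have := mulr_gt0 s0 lt; have := mulr_gt0 t0 lt => p1 p2.
  by apply/andP; split; lra.
Qed.

(** The interval lies beside [x], on the side with more room, and keeps distance [L] from both ends
    of [[0, 1]]. This margin puts its points within [1 - L] of all others, as the Hoelder estimate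
    for the perturbed densities needs. *)
Lemma holder_near (f : R -> R) (C beta x rho : R) : 0 < C -> 0 < beta ->
  x \in `[0, 1] -> 0 < rho ->
  (forall y, y \in `[0, 1] -> `|f y - f x| <= C * `|y - x| `^ beta) ->
  exists x0 L, [/\ 0 < L, L <= x0, x0 + L <= 1 - L &
    forall y, x0 <= y <= x0 + L -> `|f y - f x| <= rho].
Proof.
move=> C0 b0; rewrite in_itv/= => /andP[x0 x1] rho0 fH.
(* The second entry solves [C r ^ beta = rho]; the cap [1 / 4] provides the room at the ends. *)
pose r := Num.min (4^-1) ((rho / C) `^ beta^-1).
have rC0 : 0 < (rho / C) `^ beta^-1 by rewrite powR_gt0 ?divr_gt0.
have r0 : 0 < r by rewrite lt_min rC0 andbT; lra.
have r4 : r <= 4^-1 by rewrite ge_min lexx.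
have rr : C * r `^ beta <= rho.
  rewrite mulrC -ler_pdivlMr//.
  have -> : rho / C = ((rho / C) `^ beta^-1) `^ beta.
    by rewrite -powRrM mulVf ?gt_eqF// powRr1// divr_ge0 ?ltW.
  apply: ge0_ler_powR; rewrite ?nnegrE; [exact: ltW..|].
  by rewrite ge_min lexx orbT.
have near y : y \in `[0, 1] -> `|y - x| <= r -> `|f y - f x| <= rho.
  move=> y01 yx; apply: (le_trans (fH y y01)); apply: le_trans rr.
  by rewrite ler_pM2l// ge0_ler_powR ?nnegrE ?(ltW b0) ?(ltW r0).
have [x2|x2] := leP x 2^-1.
  exists (x + r / 2), (r / 2); split; try lra.
  move=> y /andP[y1 y2]; apply: near.
    by rewrite in_itv/=; apply/andP; split; lra.
  by rewrite ler_norml; apply/andP; split; lra.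
exists (x - r), (r / 2); split; try lra.
move=> y /andP[y1 y2]; apply: near.
  by rewrite in_itv/=; apply/andP; split; lra.
by rewrite ler_norml; apply/andP; split; lra.
Qed.

End base_density.

(** * Rates *)

Section asymptotics.
Context {R : realType}.

Lemma asymp_le_eventually (a : nat -> \bar R) (b : nat -> R) :
  asymp_le a b -> exists M N, forall n, (N <= n)%N -> 0 < b n ->
    (a n <= (M * b n)%:E)%E.
Proof.
move=> /ereal_inf_lt[_ [V [N _ NV] <-] Voo].
have [M VM] : exists M : R, (ereal_sup [set a n / (b n)%:E | n in V] <= M%:E)%E.
  move: Voo; case: (ereal_sup _) => [r|//|] _; first by exists r.
  by exists 0; rewrite leNye.
exists M, N => n Nn bn; rewrite EFinM -lee_pdivrMr//; apply: le_trans VM.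
apply: ereal_sup_ubound; exists n; first exact: NV.
by rewrite inver gt_eqF.
Qed.

Lemma asymp_ge_eventually (a : nat -> \bar R) (b : nat -> R) (c : R) N :
  0 < c -> (forall n, (N <= n)%N -> 0 < b n /\ ((c * b n)%:E <= a n)%E) ->
  asymp_ge a b.
Proof.
move=> c0 H; rewrite /asymp_ge /limn_einf oppe_gt0.
apply: (@le_lt_trans _ _ (- c%:E)%E); last by rewrite oppe_lt0 lte_fin.
apply: ge_ereal_inf.
exists (ereal_sup [set (- (a n / (b n)%:E))%E | n in [set n | (N <= n)%N]]).
  by exists [set n | (N <= n)%N] => //; exists N.
apply: ge_ereal_sup => _ [n Nn <-]; have [bn cn] := H n Nn.
by rewrite leeN2 inver gt_eqF// lee_pdivlMr// -EFinM.
Qed.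

Lemma ln_natr_gt0 n : (1 < n)%N -> 0 < ln (n%:R : R).
Proof. by move=> n1; rewrite ln_gt0// ltr1n. Qed.

(** From [ln n <= n - 1]. It makes [n ^ 2 / ln n] at least [1], so that its powers increase with the
    exponent, and unbounded. *)
Lemma natr_le_sqr_div_ln n : (1 < n)%N -> n%:R <= n%:R ^+ 2 / ln n%:R :> R.
Proof.
move=> n1; rewrite ler_pdivlMr ?ln_natr_gt0// expr2 ler_pM2l ?ltr0n 1?ltnW//.
have := @le_ln1Dx R (n%:R - 1); rewrite subrKC => H.
apply: le_trans (H _) _; last by rewrite gerBl.
by rewrite ltrBrDr addrC subrr ltr0n ltnW.
Qed.

Lemma powR_exprn (x r : R) m : (x `^ r) ^+ m = x `^ (r * m%:R).
Proof. by rewrite -powR_mulrn ?powR_ge0// powRrM. Qed.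

End asymptotics.

(** * Lower bound for a given number of cells *)

Section lower_bound.
Context {R : realType}.
Local Notation mu := (@lebesgue_measure R).
Local Notation D := (`[0%R, 1%R]%classic : set R).
Variables (Mlo Mhi C beta beta_star : R) (T T1 : R -> R) (f0 : density R).
Variables (x0 L w sg c rho kappa : R) (k : nat).
Hypotheses (Mlo_gt0 : 0 < Mlo) (Mlo_le : Mlo <= Mhi) (Mhi_leC : Mhi <= C).
Hypothesis dT : forall x, Mlo <= x <= Mhi -> is_derive x (1:R) T (T1 x).
Hypotheses (sg1 : `|sg| = 1) (c_gt0 : 0 < c).
Hypothesis curved : forall v h, `|v - w| <= rho -> `|h| <= rho ->
  Mlo <= v + h <= Mhi /\ c * h ^+ 2 <= sg * (T (v + h) + T (v - h) - 2 * T v).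
Hypothesis f0H : holder_densities Mlo Mhi C beta_star f0.
Hypotheses (L_gt0 : 0 < L) (L_le : L <= x0) (x0L : x0 + L <= 1 - L).
Hypothesis f0J : forall y, x0 <= y <= x0 + L -> `|f0 y - w| <= rho.
Hypotheses (beta_gt0 : 0 < beta) (beta_lt : beta < beta_star).
Hypothesis beta_star_le1 : beta_star <= 1.
Hypotheses (kappa_gt0 : 0 < kappa) (kappa_rho : kappa <= rho).
Hypothesis kappa_Mlo : kappa <= Mlo.
Hypothesis kappa_C : 2 * kappa <= C * (1 - (1 - L) `^ (beta_star - beta)).
Hypothesis k_gt0 : (0 < k)%N.

Let h := L / k%:R.
Let a := kappa * h `^ beta.

Let kR_gt0 : 0 < k%:R :> R. Proof. by rewrite ltr0n. Qed.

Let h_gt0 : 0 < h. Proof. by rewrite divr_gt0. Qed.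

Let kh : k%:R * h = L.
Proof. by rewrite mulrC divfK// gt_eqF. Qed.

Let h_le1 : h <= 1.
Proof.
rewrite ler_pdivrMr// mul1r (@le_trans _ _ 1) ?ler1n//.
by move: L_gt0 L_le x0L; lra.
Qed.

Let a_ge0 : 0 <= a. Proof. by rewrite mulr_ge0 ?powR_ge0// ltW. Qed.

Let a_le_kappa : a <= kappa.
Proof.
rewrite ger_pMr//; have -> : 1 = 1 `^ beta :> R by rewrite powR1.
by rewrite ge0_ler_powR ?nnegrE ?ler01 ?(ltW h_gt0) ?(ltW beta_gt0).
Qed.

Let norm_a : `|a| = a. Proof. exact: ger0_norm. Qed.

Let a_le : `|a| <= Mlo. Proof. by rewrite norm_a (le_trans a_le_kappa). Qed.

Let x0_ge0 : 0 <= x0. Proof. exact: le_trans (ltW L_gt0) L_le. Qed.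

Let x0kh : x0 + k%:R * h <= 1. Proof. by rewrite kh; move: L_gt0 x0L; lra. Qed.

Let f0_ge x : x \in `[0, 1] -> Mlo <= f0 x.
Proof. by move=> /(f0H.2 x) /andP[]. Qed.

Local Notation g := (@perturbation R x0 h a k).
Local Notation fs := (perturbed_density h_gt0 x0_ge0 k_gt0 x0kh f0_ge a_le).

Let g_le s x : `|g s x| <= a. Proof. by rewrite -{2}norm_a; exact: perturbation_le. Qed.

Let g_cases (s : {ffun 'I_k -> bool}) x :
  g s x = 0 \/ x0 < x < x0 + L.
Proof.
have [xJ|xJ] := boolP (x0 < x < x0 + L); [by right|left].
by apply: perturbation_out; rewrite ?kh.
Qed.

Let f0g_between (s : {ffun 'I_k -> bool}) x : x \in `[0, 1] ->
  Mlo <= f0 x + g s x <= Mhi.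
Proof.
move=> x01; have [->|/andP[xl xr]] := g_cases s x.
  by rewrite addr0; exact: (f0H.2 x x01).
have [||//] := curved (v := f0 x) (h := g s x).
- by apply: f0J; rewrite !ltW.
- exact: le_trans (g_le s x) (le_trans a_le_kappa kappa_rho).
Qed.

(* If [x] or [y] is in the support of the bumps then [|x - y| <= 1 - L], and
   [C |x - y| ^ beta_star] falls short of [C |x - y| ^ beta] by a fixed fraction,
   which leaves room for the bumps. *)
Lemma perturbed_holder (s : {ffun 'I_k -> bool}) :
  holder_densities Mlo Mhi C beta (fs s).
Proof.
split; last by move=> x x01; exact: f0g_between.
split.
  move=> x x01; have /andP[lo hi] := f0g_between s x01.
  rewrite /= /perturbed_fun ger0_norm; first exact: le_trans hi Mhi_leC.
  by apply: le_trans lo; exact: ltW.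
move=> x y x01 y01; rewrite /= /perturbed_fun.
have [->|xy] := eqVneq x y.
  rewrite !subrr normr0 mulr_ge0 ?powR_ge0//.
  by apply: le_trans Mhi_leC; apply: le_trans Mlo_le; exact: ltW.
have xy_gt0 : 0 < `|x - y| by rewrite normr_gt0 subr_eq0.
have C_ge0 : 0 <= C.
  by apply: le_trans Mhi_leC; apply: le_trans Mlo_le; exact: ltW.
have f0xy : `|f0 x - f0 y| <=
    C * `|x - y| `^ (beta_star - beta) * `|x - y| `^ beta.
  rewrite -mulrA -powRD ?subrK; last by apply/implyP => _; rewrite gt_eqF.
  exact: f0H.1.2.
have [/andP[x0' x1'] /andP[y0' y1']] : 0 <= x <= 1 /\ 0 <= y <= 1.
  by move: x01 y01; rewrite !in_itv.
have xy_le1 : `|x - y| <= 1 by rewrite ler_norml; apply/andP; split; lra.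
have hL := L_le; have hxL := x0L.
have bb : 0 <= beta_star - beta by rewrite subr_ge0 ltW.
have [[gx gy]|xyJ] : (g s x = 0 /\ g s y = 0) \/ `|x - y| <= 1 - L.
  have [gx|/andP[xl xr]] := g_cases s x; last first.
    by right; rewrite ler_norml; apply/andP; split; lra.
  have [gy|/andP[yl yr]] := g_cases s y; first by left.
  by right; rewrite ler_norml; apply/andP; split; lra.
- rewrite gx gy !addr0; apply: (le_trans f0xy).
  rewrite ler_wpM2r ?powR_ge0// ler_piMr//.
  have -> : 1 = 1 `^ (beta_star - beta) :> R by rewrite powR1.
  by rewrite ge0_ler_powR ?nnegrE.
have -> : f0 x + g s x - (f0 y + g s y) = (f0 x - f0 y) + (g s x - g s y) by ring.
apply: (le_trans (ler_normD _ _)).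
(* The height [kappa * h ^ beta] cancels the cell width, so the Hoelder constant of the perturbation
   is [2 * kappa] for every [k]. *)
have gxy : `|g s x - g s y| <= 2 * kappa * `|x - y| `^ beta.
  have beta_le1 := le_trans (ltW beta_lt) beta_star_le1.
  have := perturbation_holder x0 a h_gt0 k_gt0 s x y beta_gt0 beta_le1.
  have hb : h `^ beta != 0 by rewrite gt_eqF// powR_gt0.
  rewrite norm_a powRM ?invr_ge0 ?(ltW h_gt0)// -powR_inv1 ?(ltW h_gt0)//.
  rewrite -powRrM mulN1r powRN.
  have -> : 2 * a * (`|x - y| `^ beta / h `^ beta) = 2 * kappa * `|x - y| `^ beta.
    by rewrite /a; field.
  exact.
apply: (le_trans (lerD f0xy gxy)); rewrite -mulrDl ler_wpM2r ?powR_ge0//.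
have : C * `|x - y| `^ (beta_star - beta) <= C * (1 - L) `^ (beta_star - beta).
  by rewrite ler_wpM2l// ge0_ler_powR ?nnegrE// (le_trans (ltW xy_gt0) xyJ).
by have := kappa_C; lra.
Qed.

(* The squared bump exceeds [bump_min ^ 2] on a quarter of its cell, and the
   cells have total length [L]. *)
Definition separation : R := c * a ^+ 2 * (L / 4 * bump_min R ^+ 2) / 2.

(** For opposite signs the two increments of [phi T] add up to an integrated second difference of
    [T], at least [c] times the squared perturbation. One increment of such a pair may still be
    small, so the bound concerns the average over signs. *)
Lemma separation_le :
  separation * #|{ffun 'I_k -> bool}|%:R <=
  \sum_s `|phi T (fs s) - phi T f0|.
Proof.
pose neg (s : {ffun 'I_k -> bool}) := [ffun j => ~~ s j].
have negK : involutive neg by move=> s; apply/ffunP => j; rewrite !ffunE negbK.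
have intT s : mu.-integrable D (EFin \o (T \o fs s)).
  apply: (integrable_comp Mlo_le dT); first exact: density_measurable.
  by move=> x x01; exact: f0g_between.
have intT0 : mu.-integrable D (EFin \o (T \o f0)).
  apply: (integrable_comp Mlo_le dT); first exact: density_measurable.
  exact: f0H.2.
have pair s : 2 * separation <=
    `|phi T (fs s) - phi T f0| + `|phi T (fs (neg s)) - phi T f0|.
  apply: (@le_trans _ _ `|sg * (phi T (fs s) - phi T f0 +
      (phi T (fs (neg s)) - phi T f0))|); last first.
    by rewrite normrM sg1 mul1r; exact: ler_normD.
  have -> : sg * (phi T (fs s) - phi T f0 + (phi T (fs (neg s)) - phi T f0)) =
    \int[mu]_(x in D) (sg * (T (fs s x) + T (fs (neg s) x) - 2 * T (f0 x))).
    have i1 : mu.-integrable D (EFin \o (fun x => T (fs s x) + T (fs (neg s) x))).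
      by apply: (integrableD _ (intT s) (intT (neg s))).
    have i2 : mu.-integrable D (EFin \o (fun x => 2 * T (f0 x))).
      exact: integrableZl intT0.
    rewrite RintegralZl//; last by apply: (integrableB _ i1 i2).
    rewrite RintegralB// RintegralD//; last 2 first.
    - exact: intT.
    - exact: intT.
    rewrite RintegralZl// /phi; ring.
  apply: le_trans (ler_norm _).
  apply: (@le_trans _ _ (\int[mu]_(x in D) (c * g s x ^+ 2))).
    rewrite RintegralZl//; last first.
      apply: (@integrable01 _ (a ^+ 2)).
        by apply: measurable_funX; exact: measurable_perturbation.
      by move=> x _; rewrite normrX lerXn2r ?nnegrE.
    have := Rintegral_perturbation_sqr a h_gt0 x0_ge0 k_gt0 x0kh s.
    rewrite -(ler_pM2l c_gt0); apply: le_trans.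
    rewrite /separation le_eqVlt; apply/orP; left; apply/eqP.
    rewrite (_ : k%:R * (h / 4 * bump_min R ^+ 2) =
      k%:R * h / 4 * bump_min R ^+ 2); last by rewrite !mulrA.
    by rewrite kh; field.
  apply: le_Rintegral => //.
  - apply: (@integrable01 _ (c * a ^+ 2)).
      apply: measurable_funM => //.
      by apply: measurable_funX; exact: measurable_perturbation.
    move=> x _; rewrite normrM (gtr0_norm c_gt0) ler_pM2l// normrX.
    by rewrite lerXn2r ?nnegrE.
  - have i1 : mu.-integrable D (EFin \o (fun x => T (fs s x) + T (fs (neg s) x))).
      by apply: (integrableD _ (intT s) (intT (neg s))).
    have i2 : mu.-integrable D (EFin \o (fun x => 2 * T (f0 x))).
      exact: integrableZl intT0.
    have i3 : mu.-integrable D (EFin \o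
        (fun x => T (fs s x) + T (fs (neg s) x) - 2 * T (f0 x))).
      by apply: (integrableB _ i1 i2).
    exact: integrableZl i3.
  move=> x x01; rewrite /= /perturbed_fun perturbation_neg.
  have [->|/andP[xl xr]] := g_cases s x.
    by rewrite oppr0 addr0 expr0n/= mulr0 mulr_natl mulr2n subrr mulr0.
  have [||_ //] := curved (v := f0 x) (h := g s x).
  - by apply: f0J; rewrite !ltW.
  - exact: le_trans (g_le s x) (le_trans a_le_kappa kappa_rho).
rewrite -(@ler_pM2l _ 2)// mulrA.
(* Negation permutes the sign vectors, so summing the pair bound counts each of them twice. *)
have -> : 2 * \sum_s `|phi T (fs s) - phi T f0| =
    \sum_s (`|phi T (fs s) - phi T f0| + `|phi T (fs (neg s)) - phi T f0|).
  rewrite big_split/= [X in _ = _ + X](_ : _ = \sum_s `|phi T (fs s) - phi T f0|).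
    by rewrite mulr_natl mulr2n.
  by rewrite [RHS](reindex_inj (inv_inj negK)).
have -> : 2 * separation * #|{ffun 'I_k -> bool}|%:R =
    \sum_(s : {ffun 'I_k -> bool}) 2 * separation.
  by rewrite sumr_const mulr_natr.
by apply: ler_sum => s _; exact: pair.
Qed.

(** The bound of [sum_signs_chi2] with each of the [k] weights replaced by its upper bound
    [a ^+ 2 * (h / Mlo)]. *)
Definition chi2_bound (n : nat) : R :=
  expR (2 * n%:R ^+ 2 * (k%:R * (a ^+ 2 * (h / Mlo)) ^+ 2)).

Lemma risk_lower_bound n (est : n.-tuple R -> R) (e r : R) :
  measurable_fun setT est ->
  (risk T f0 est <= e%:E)%E ->
  16 * e * chi2_bound n <= separation ^+ 2 ->
  (forall s : {ffun 'I_k -> bool}, (risk T (fs s) est <= r%:E)%E) ->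
  separation ^+ 2 / 2 <= r.
Proof.
move=> mest riskf0 eD riskfs.
have f0_gt0 x : x \in `[0, 1] -> 0 < f0 x.
  by move=> /f0_ge; exact: lt_le_trans.
pose z (j : 'I_k) := a ^+ 2 * cell_weight x0 h f0 j.
pose chi (s t : {ffun 'I_k -> bool}) := 1 + \sum_j (-1) ^+ s j * (-1) ^+ t j * z j.
have chiE s t : (\int[density_prob f0]_x
    (density_ratio (fs s) f0 x * density_ratio (fs t) f0 x)%:E = (chi s t)%:E)%E.
  rewrite integral_density_ratioM// (perturbed_density_chi2 _ _ _ _ Mlo_gt0).
  congr (_%:E).
  rewrite /chi mulr_sumr; congr (_ + _); apply: eq_bigr => j _.
  by rewrite /z mulrCA.
have chi_ge0 s t : 0 <= chi s t.
  rewrite -lee_fin -chiE; apply: integral_ge0 => x _.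
  by rewrite lee_fin mulr_ge0// density_ratio_ge0.
have sep_gt0 : 0 < separation.
  have a_gt0 : 0 < a by rewrite mulr_gt0// powR_gt0.
  rewrite /separation; apply: divr_gt0 => //; apply: mulr_gt0.
    by rewrite mulr_gt0// exprn_gt0.
  by rewrite mulr_gt0 ?(exprn_gt0 _ (bump_min_gt0 R)) ?divr_gt0.
apply: (@constrained_risk_lower_bound _ _ _ {ffun 'I_k -> bool}
  (density_prob f0) (fun s => density_prob (fs s))
  (fun s => density_ratio (fs s) f0) _ _ _ n est (phi T f0)
  (fun s => phi T (fs s)) _ chi chiE r e (chi2_bound n) separation) => //.
- by move=> s; exact: measurable_density_ratio.
- by move=> s x; exact: density_ratio_ge0.
- by move=> s u mu0 u0; exact: ge0_integral_density_ratio.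
- exact: expR_gt0.
- by rewrite card_ffun card_bool expn_gt0.
- exact: separation_le.
- apply: (le_trans (sum_signs_chi2 n chi_ge0)).
  rewrite ler_wpM2r ?exprn_ge0// ler_expR ler_wpM2l//.
  apply: (@le_trans _ _ (\sum_(j < k) (a ^+ 2 * (h / Mlo)) ^+ 2)); last first.
    by rewrite sumr_const card_ord mulr_natl.
  have w0 j : 0 <= cell_weight x0 h f0 j by exact: (cell_weight_ge0 _ _ Mlo_gt0 f0_ge).
  have z0 j : 0 <= z j by rewrite mulr_ge0 ?sqr_ge0.
  have zle j : z j <= a ^+ 2 * (h / Mlo).
    by rewrite ler_wpM2l ?sqr_ge0//; exact: cell_weight_le.
  apply: ler_sum => j _; rewrite lerXn2r ?nnegrE//.
  exact: le_trans (z0 j) (zle j).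
- by move: riskf0; rewrite /risk unlock.
- by move=> s; move: (riskfs s); rewrite /risk unlock.
Qed.

Lemma max_risk_lower_bound n (est : n.-tuple R -> R) (e : R) :
  measurable_fun setT est ->
  (risk T f0 est <= e%:E)%E ->
  16 * e * chi2_bound n <= separation ^+ 2 ->
  ((separation ^+ 2 / 2)%:E <=
    max_risk T (holder_densities Mlo Mhi C beta) est)%E.
Proof.
move=> mest riskf0 eD.
have riskfs s : (risk T (fs s) est <=
    max_risk T (holder_densities Mlo Mhi C beta) est)%E.
  by apply: ereal_sup_ubound; exists (fs s) => //; exact: perturbed_holder.
case E : max_risk => [r||]; [|by rewrite leey|].
  rewrite lee_fin; apply: (risk_lower_bound mest riskf0 eD) => s.
  by rewrite -E.
(* A supremum equal to [-oo] would allow every real [r] in [risk_lower_bound], even one below its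
   conclusion. *)
have : separation ^+ 2 / 2 <= separation ^+ 2 / 2 - 1.
  apply: (risk_lower_bound mest riskf0 eD) => s.
  by apply: (le_trans (riskfs s)); rewrite E leNye.
by rewrite lerBrDr gerDl ler10.
Qed.

End lower_bound.

(** * Choice of the number of cells *)

Section tuning.
Context {R : realType}.
Variables (Mlo beta L c kappa : R).
Hypotheses (Mlo_gt0 : 0 < Mlo) (beta_gt0 : 0 < beta).
Hypotheses (L_gt0 : 0 < L) (L_le1 : L <= 1) (c_gt0 : 0 < c) (kappa_gt0 : 0 < kappa).

Definition effective_size (n : nat) : R := n%:R ^+ 2 / ln n%:R.

(** With [y] the power inside, the successor gives [y < k <= 2 y] once [y >= 1]. The first
    inequality makes [h] small enough for the chi-square bound, the second large enough for the
    separation. *)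
Definition cell_number (n : nat) : nat :=
  (Num.truncn (effective_size n `^ (1 + 4 * beta)^-1)).+1.

Section fixed_sample_size.
Variable n : nat.
Hypothesis n_gt1 : (1 < n)%N.

Let x := effective_size n.
Let y := x `^ (1 + 4 * beta)^-1.
Let k := cell_number n.
Let h := L / k%:R.

Let b1_gt0 : 0 < 1 + 4 * beta. Proof. by move: beta_gt0; lra. Qed.

Let x_ge : n%:R <= x. Proof. exact: natr_le_sqr_div_ln. Qed.

Let n_ge1 : 1 <= n%:R :> R. Proof. by rewrite ler1n ltnW. Qed.

Let x_ge1 : 1 <= x. Proof. exact: le_trans x_ge. Qed.

Let x_gt0 : 0 < x. Proof. exact: lt_le_trans x_ge1. Qed.

Let y_ge1 : 1 <= y.
Proof.
rewrite /y -[X in X <= _](powRr0 x); apply: ler_powR => //.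
by rewrite invr_ge0 ltW.
Qed.

Let y_gt0 : 0 < y. Proof. exact: lt_le_trans y_ge1. Qed.

Let k_gt : y < k%:R. Proof. exact: truncnS_gt. Qed.

Let k_le : k%:R <= 2 * y.
Proof.
rewrite /k /cell_number -natr1.
have /andP[ty _] := truncn_itv (ltW y_gt0).
have := y_ge1; move: ty; rewrite -/x -/y; lra.
Qed.

Let k_gt0 : 0 < k%:R :> R. Proof. by rewrite ltr0n. Qed.

Let h_gt0 : 0 < h. Proof. by rewrite divr_gt0. Qed.

Let powR_invy r : y^-1 `^ r = x `^ (- (r / (1 + 4 * beta))).
Proof.
rewrite -powR_inv1 ?(ltW y_gt0)// /y -!powRrM; congr (_ `^ _).
by rewrite mulN1r mulrN mulrC.
Qed.

(** The squared [separation] without its power of [h], times the factor lost in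
    [h >= (L / 2) / y]. *)
Definition separation_cst : R :=
  (c * kappa ^+ 2 * (L / 4 * bump_min R ^+ 2) / 2) ^+ 2 * (L / 2) `^ (4 * beta).

Lemma separation_cst_gt0 : 0 < separation_cst.
Proof.
have L4 : 0 < L / 4 by exact: divr_gt0.
have c2 : 0 < c * kappa ^+ 2 by rewrite mulr_gt0// exprn_gt0.
rewrite mulr_gt0 ?powR_gt0 ?divr_gt0// exprn_gt0// divr_gt0// mulr_gt0//.
by rewrite mulr_gt0 ?(exprn_gt0 _ (bump_min_gt0 R)) ?divr_gt0.
Qed.

Lemma separation_ge :
  separation_cst * adaptive_rate beta n <= separation beta L c kappa k ^+ 2.
Proof.
have -> : separation beta L c kappa k ^+ 2 =
  (c * kappa ^+ 2 * (L / 4 * bump_min R ^+ 2) / 2) ^+ 2 * h `^ (4 * beta).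
  rewrite (mulrC 4 beta) -(powR_exprn h beta 4) /separation -/h.
  by field.
rewrite /separation_cst -mulrA ler_wpM2l ?sqr_ge0//.
rewrite /adaptive_rate -/(effective_size n) -/x -powR_invy.
rewrite -powRM ?invr_ge0 ?divr_ge0 ?(ltW y_gt0) ?(ltW L_gt0)//.
rewrite ge0_ler_powR ?nnegrE ?mulr_ge0 ?invr_ge0 ?divr_ge0 ?(ltW y_gt0)
  ?(ltW L_gt0) ?(ltW beta_gt0)//.
rewrite /h -mulrA ler_pM2l// -invfM lef_pV2 ?posrE ?mulr_gt0//.
Qed.

(** As [k h = L <= 1] and [h ^ (1 + 4 beta) <= 1 / x], the exponent is at most [2 kappa^4 / Mlo^2]
    times [n^2 / x = ln n]. Then [n <= x] yields a power of [x], the base in which the rates are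
    written. *)
Lemma chi2_bound_le :
  chi2_bound Mlo beta L kappa k n <= x `^ (2 * kappa ^+ 4 / Mlo ^+ 2).
Proof.
have x_neq0 : x != 0 by rewrite gt_eqF.
rewrite /powR (negbTE x_neq0) /chi2_bound -/h ler_expR.
apply: (@le_trans _ _ (2 * kappa ^+ 4 / Mlo ^+ 2 * ln n%:R)); last first.
  rewrite ler_wpM2l//; last by rewrite ler_ln ?posrE// ltr0n ltnW.
  by rewrite divr_ge0 ?sqr_ge0// mulr_ge0// exprn_ge0// ltW.
have -> : 2 * n%:R ^+ 2 * (k%:R * ((kappa * h `^ beta) ^+ 2 * (h / Mlo)) ^+ 2) =
    2 * kappa ^+ 4 / Mlo ^+ 2 * (n%:R ^+ 2 * (k%:R * h * (h `^ (4 * beta) * h))).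
  rewrite (mulrC 4 beta) -(powR_exprn h beta 4).
  by field; rewrite gt_eqF.
rewrite ler_wpM2l//.
  by rewrite divr_ge0 ?sqr_ge0// mulr_ge0// exprn_ge0// ltW.
have hy : h `^ (4 * beta) * h <= x^-1.
  have -> : x^-1 = y^-1 `^ (4 * beta + 1).
    rewrite powR_invy -powR_inv1 ?(ltW x_gt0)//; congr (_ `^ _).
    by rewrite addrC divff ?gt_eqF.
  rewrite -{2}(powRr1 (ltW h_gt0)) -powRD; last first.
    by apply/implyP => _; rewrite gt_eqF.
  rewrite ge0_ler_powR ?nnegrE ?invr_ge0 ?(ltW h_gt0) ?(ltW y_gt0)//.
    by move: beta_gt0; lra.
  rewrite /h ler_pdivrMr// (le_trans L_le1)// mulrC ler_pdivlMr// mul1r.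
  exact: ltW.
have -> : k%:R * h = L by rewrite mulrC divfK// gt_eqF.
have ln_gt0 : 0 < ln n%:R :> R by exact: ln_natr_gt0.
have n_gt0 : 0 < n%:R :> R by rewrite ltr0n ltnW.
have -> : ln n%:R = n%:R ^+ 2 * x^-1 :> R.
  by rewrite /x /effective_size; field; rewrite !gt_eqF.
rewrite ler_wpM2l ?sqr_ge0// -[leRHS]mul1r ler_pM//; first exact: ltW.
by rewrite mulr_ge0 ?powR_ge0// ltW.
Qed.

End fixed_sample_size.
End tuning.

Lemma rate_exponent_lt (R : realFieldType) (beta beta_star : R) :
  0 < beta -> beta < beta_star ->
  4 * beta / (1 + 4 * beta) < 4 * beta_star / (1 + 4 * beta_star).
Proof.
move=> b0 bb.
rewrite ltr_pdivrMr; last by lra.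
rewrite mulrAC ltr_pdivlMr; last by lra.
by lra.
Qed.

Unset Implicit Arguments.

Theorem theorem7p2 (R : realType) (Mlo Mhi C : R)
    (Mlo_gt0 : 0 < Mlo) (Mlo_lt1 : Mlo < 1) (Mhi_gt1 : 1 < Mhi)
    (Mhi_leC : Mhi <= C)
    (T : R -> R) (T3 : bounded_third_derivative Mlo Mhi T)
    (T_nonaffine : ~ affine_on Mlo Mhi T)
    (beta_star : R) (beta_star_gt0 : 0 < beta_star)
    (beta_star_lt : beta_star < 4^-1)
    (phi_nonlinear :
      ~ phi_affine_on (holder_densities Mlo Mhi C beta_star) T)
    (est : forall n : nat, n.-tuple R -> R)
    (est_measurable : forall n, measurable_fun setT (est n))
    (est_rate : asymp_le
      (fun n => max_risk T (holder_densities Mlo Mhi C beta_star) (est n))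
      (adaptive_rate beta_star))
    (beta : R) (beta_gt0 : 0 < beta) (beta_lt : beta < beta_star) :
  asymp_ge
    (fun n => max_risk T (holder_densities Mlo Mhi C beta) (est n))
    (adaptive_rate beta).
Proof.
pose T1 : R -> R := T^`()%classic; pose T2 : R -> R := T1^`()%classic.
have dT x : Mlo <= x <= Mhi -> is_derive x (1:R) T (T1 x).
  by move=> xab; apply: is_derive_derive1; apply: (T3.1 0%N) => //; rewrite in_itv.
have ddT x : Mlo <= x <= Mhi -> is_derive x (1:R) T1 (T2 x).
  by move=> xab; apply: is_derive_derive1; apply: (T3.1 1%N) => //; rewrite in_itv.
have Mlo_le : Mlo <= Mhi by lra.
have C_gt0 : 0 < C by lra.
have [f0 [z [f0H z01 f0z T2z]]] :=
  exists_curved_density Mlo_le dT ddT phi_nonlinear.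
have cT2 : {for f0 z, continuous T2}.
  apply: differentiable_continuous; apply/derivable1_diffP.
  by apply: (T3.1 2%N) => //; rewrite in_itv/=; move: f0z => /andP[/ltW-> /ltW->].
have [sg [c [rho [sg1 c_gt0 rho_gt0 curved]]]] := curvature_nbhd dT ddT cT2 f0z T2z.
have [x0 [L [L_gt0 L_le x0L f0J]]] := holder_near C_gt0 beta_star_gt0 z01 rho_gt0
  (fun y y01 => f0H.1.2 y z y01 z01).
have L_le1 : L <= 1 by lra.
pose gap := 4 * beta_star / (1 + 4 * beta_star) - 4 * beta / (1 + 4 * beta).
have gap_gt0 : 0 < gap by rewrite subr_gt0 rate_exponent_lt.
pose slack := C * (1 - (1 - L) `^ (beta_star - beta)) / 2.
have slack_gt0 : 0 < slack.
  rewrite divr_gt0// mulr_gt0// subr_gt0.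
  rewrite -[ltRHS](_ : 1 `^ (beta_star - beta) = 1); last by rewrite powR1.
  by apply: gt0_ltr_powR; rewrite ?nnegrE ?subr_gt0 ?subr_ge0 ?gtrBl ?ler01.
(* In turn: the range where the curvature bound holds, the room in the Hoelder constant, positivity
   of the perturbed densities, and two bounds that give [kappa ^ 4 <= kappa] and then
   [delta <= gap / 2]. *)
pose kappa := Num.min (Num.min rho slack)
  (Num.min Mlo (Num.min 1 (gap / 4 * Mlo ^+ 2))).
have kappa_gt0 : 0 < kappa.
  by rewrite !lt_min rho_gt0 slack_gt0 Mlo_gt0 ltr01 mulr_gt0 ?exprn_gt0 ?divr_gt0.
have [k1 k2 k3 [k4 k5]] : [/\ kappa <= rho, kappa <= slack, kappa <= Mlo &
    kappa <= 1 /\ kappa <= gap / 4 * Mlo ^+ 2].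
  by rewrite /kappa !ge_min !lexx !orbT; split.
have kappa_C : 2 * kappa <= C * (1 - (1 - L) `^ (beta_star - beta)).
  by move: k2; rewrite /slack; lra.
pose delta := 2 * kappa ^+ 4 / Mlo ^+ 2.
have delta_le : delta <= gap / 2.
  rewrite ler_pdivrMr ?exprn_gt0//.
  have : kappa ^+ 4 <= kappa by rewrite exprS ger_pMr// exprn_ile1// ltW.
  by lra.
have [M [N0 riskM]] := asymp_le_eventually est_rate.
pose c2 := separation_cst beta L c kappa.
have c2_gt0 : 0 < c2 by exact: separation_cst_gt0.
(* Half of [gap] absorbs the chi-square power [delta]; the other half absorbs the constant [B],
   because [effective_size n >= n] exceeds [B ^ (2 / gap)] from [N1] on. *)
pose B := 16 * `|M| / c2.
have B_ge0 : 0 <= B by rewrite divr_ge0 ?(ltW c2_gt0)// mulr_ge0.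
pose N1 := (Num.truncn (B `^ (gap / 2)^-1)).+1.
apply: (@asymp_ge_eventually _ _ _ (c2 / 2) (maxn 2 (maxn N0 N1))).
  by rewrite divr_gt0.
move=> n; rewrite !geq_max => /and3P[n2 nN0 nN1].
have x_ge : n%:R <= effective_size n :> R by exact: natr_le_sqr_div_ln.
have x_ge1 : 1 <= effective_size n :> R.
  by apply: le_trans x_ge; rewrite ler1n ltnW.
have x_gt0 : 0 < effective_size n :> R by exact: lt_le_trans x_ge1.
have rate_gt0 b : 0 < adaptive_rate b n :> R by exact: powR_gt0.
split => //.
have risk0 : (risk T f0 (est n) <= (`|M| * adaptive_rate beta_star n)%:E)%E.
  apply: (@le_trans _ _ (max_risk T (holder_densities Mlo Mhi C beta_star) (est n))).
    by apply: ereal_sup_ubound; exists f0.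
  apply: (le_trans (riskM n nN0 (rate_gt0 _))).
  by rewrite lee_fin ler_pM2r// ler_norm.
have sep := separation_ge c kappa beta_gt0 L_gt0 n2.
have chi := chi2_bound_le Mlo_gt0 beta_gt0 L_gt0 L_le1 kappa_gt0 n2.
apply: (@le_trans _ _ (separation beta L c kappa (cell_number beta n) ^+ 2 / 2)%:E).
  by rewrite lee_fin mulrAC ler_pM2r ?invr_gt0.
have B_le : B <= effective_size n `^ (gap / 2).
  have gap2 : 0 < gap / 2 by rewrite divr_gt0.
  have -> : B = (B `^ (gap / 2)^-1) `^ (gap / 2).
    by rewrite -powRrM mulVf ?gt_eqF// powRr1.
  rewrite ge0_ler_powR ?nnegrE ?powR_ge0 ?(ltW gap2) ?(ltW x_gt0)//.
  apply: le_trans x_ge; apply: ltW; apply: (lt_le_trans (truncnS_gt _)).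
  by rewrite ler_nat.
apply: (max_risk_lower_bound (k := cell_number beta n) Mlo_gt0 Mlo_le Mhi_leC dT
  sg1 c_gt0 curved f0H L_gt0 L_le x0L f0J beta_gt0 beta_lt _ kappa_gt0 k1 k3 kappa_C
  _ (est_measurable n) risk0) => //; first by lra.
apply: le_trans sep.
apply: (@le_trans _ _ (16 * (`|M| * adaptive_rate beta_star n) *
    effective_size n `^ delta)).
  by rewrite ler_wpM2l// !mulr_ge0// ltW.
have -> : 16 * (`|M| * adaptive_rate beta_star n) * effective_size n `^ delta =
    B * c2 * (adaptive_rate beta_star n * effective_size n `^ delta).
  by rewrite /B divfK ?gt_eqF//; ring.
rewrite mulrAC mulrC -/c2 ler_pM2l//.
apply: (@le_trans _ _ (effective_size n `^ (gap / 2) *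
    (adaptive_rate beta_star n * effective_size n `^ delta))).
  by rewrite ler_pM2r// mulr_gt0// powR_gt0.
rewrite /adaptive_rate -/(effective_size n) -!powRD; last 2 first.
- by apply/implyP => _; rewrite gt_eqF.
- by apply/implyP => _; rewrite gt_eqF.
by apply: ler_powR => //; move: delta_le; rewrite /gap; lra.
Qed.
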